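(* Let $\varepsilon>0$ and let $f(z,\omega)=\sum_{n=0}^{+\infty}\xi_n(\omega)a_nz^n$, where $(\xi_n)$ are independent standard complex gaussian random variables and $a_n\in\mathbb{C}$ satisfy $\#\{n\colon a_n\neq0\}=+\infty$, $\varlimsup_{n\to+\infty}\sqrt[n]{|a_n|}=0$ and $a_0\neq0$. Then there exists a set $E\subset(1;+\infty)$ of finite logarithmic measure such that for all $r\in(1;+\infty)\setminus E$, $$p_0(r)\le s(r)+N(r)\exp\{(2+\varepsilon)\sqrt{\ln N(r)}\}.$$
   Context: A standard complex gaussian random variable has density $\frac1\pi e^{-|z|^2}$ on $\mathbb{C}$. $n_f(r,\omega)$ is the number of zeros of $z\mapsto f(z,\omega)$ in the disc $\{|z|<r\}$, and $p_0(r)=\ln^-P\{\omega\colon n_f(r,\omega)=0\}=-\ln P\{\omega\colon n_f(r,\omega)=0\}$. $N(r)=\#\{n\colon\ln(|a_n|r^n)>0\}$ and $s(r)=2\sum_{n\colon\ln(|a_n|r^n)>0}\ln(|a_n|r^n)$. A set $E\subset(1,+\infty)$ has finite logarithmic measure if $\int_E\frac{dr}{r}<+\infty$. *)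

(* Defs.v *)
From HB Require Import structures.
From mathcomp Require Import all_boot all_order all_algebra.
From mathcomp Require Import all_classical all_reals all_analysis.
From mathcomp Require Import complex.

Set Implicit Arguments.
Unset Strict Implicit.
Unset Printing Implicit Defensive.

Import Order.TTheory GRing.Theory Num.Theory.
Import numFieldNormedType.Exports.
Local Open Scope classical_set_scope.
Local Open Scope ring_scope.

Notation normc := ComplexField.Normc.normc.

Section Defs.
Variable R : realType.
Variables (d : measure_display) (T : measurableType d).
Variable P : probability T R.

(** xi = X + iY is a standard complex gaussian random variable:
    its law has density (1/pi) exp(-|z|^2) w.r.t. Lebesgue measure on C = R^2. *)
Definition std_complex_gaussian (X Y : T -> R) : Prop :=
  measurable_fun setT X /\ measurable_fun setT Y /\
  forall A : set (R * R), measurable A ->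
    P [set w | A (X w, Y w)] =
    (\int[(@lebesgue_measure R) \x (@lebesgue_measure R)]_(z in A)
        ((pi^-1 * expR (- (z.1 ^+ 2 + z.2 ^+ 2)))%:E))%E.

Definition mutually_independent (X Y : nat -> T -> R) : Prop :=
  forall (s : seq nat) (A : nat -> set (R * R)),
    uniq s -> (forall i, i \in s -> measurable (A i)) ->
    P (\bigcap_(i in [set` s]) [set w | A i (X i w, Y i w)]) =
    (\big[*%E/1%E]_(i <- s) P [set w | A i (X i w, Y i w)])%E.

Definition xi (X Y : nat -> T -> R) (n : nat) (w : T) : R[i] :=
  (X n w +i* Y n w)%C.

Definition psum (X Y : nat -> T -> R) (a : nat -> R[i]) (z : R[i]) (w : T)
  (N : nat) : R[i] :=
  \sum_(n < N) xi X Y n w * a n * z ^+ n.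

Definition f_is (X Y : nat -> T -> R) (a : nat -> R[i]) (z : R[i]) (w : T)
  (l : R[i]) : Prop :=
  (fun N => normc (psum X Y a z w N - l)) @ \oo --> (0 : R).

Definition no_zero_event (X Y : nat -> T -> R) (a : nat -> R[i]) (r : R) : set T :=
  [set w | forall z : R[i], normc z < r ->
             exists l, f_is X Y a z w l /\ l != 0].

(** p_0(r) = - ln P{w : n_f(r,w) = 0}  (= +oo if the probability is 0) *)
Definition p0 (X Y : nat -> T -> R) (a : nat -> R[i]) (r : R) : \bar R :=
  (- lne (P (no_zero_event X Y a r)))%E.

End Defs.

Section Defs2.
Variable R : realType.

Definition Ncount (a : nat -> R[i]) (r : R) : \bar R :=
  (\sum_(0 <= n <oo) (if 0 < ln (normc (a n) * r ^+ n) then 1 else 0)%:E)%E.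

Definition s_r (a : nat -> R[i]) (r : R) : \bar R :=
  (2%:E * \sum_(0 <= n <oo)
     (if 0 < ln (normc (a n) * r ^+ n) then ln (normc (a n) * r ^+ n) else 0)%:E)%E.

Definition finite_log_measure (E : set R) : Prop :=
  measurable E /\
  (\int[@lebesgue_measure R]_(x in E) (x^-1)%:E < +oo)%E.

End Defs2.

(* Main.v *)
Require Import Defs.
From HB Require Import structures.
From mathcomp Require Import all_boot all_order all_algebra.
From mathcomp Require Import all_classical all_reals all_analysis.
From mathcomp Require Import complex.
From mathcomp Require Import measurable_realfun ring lra zify.
Import Order.TTheory GRing.Theory Num.Theory.
Import numFieldNormedType.Exports.
Local Open Scope classical_set_scope.
Local Open Scope ring_scope.

(** Write b_n = |a_n| r^n and N = N(r), choose j with j^2 <= N < (j+1)^2, let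
    g_j = 1/(1 + ln (j+1)) - 1/(1 + ln (j+2)), and put q = 1 + g_j.
    If R_j is the radius at which the counting function reaches (j+1)^2, the
    intervals [R_j / q^2, R_j] have summable logarithmic lengths at most 3 g_j,
    and for r outside them the disc of radius r q^2 still counts fewer than
    (j+1)^2 indices.  So at most 2j indices have b_n <= 1 < b_n q^(2n), and all the
    others with b_n <= 1 satisfy b_n <= q^(-2n).
    The series has no zero in |z| < r once |xi_0| > K / |a_0| and, for n >= 1,
    |xi_n| <= rho_n, where rho_n is 1/(N b_n) if b_n > 1, 1 if b_n <= 1 < b_n q^(2n)
    and q^n otherwise: then the sum of the |xi_n| b_n over n >= 1 is at most
    K = 1 + (2j+1) + 1/g_j = O(sqrt N (1 + ln N)^2).  By independence this event has
    probability at least exp (- s(r) - O(N (1 + ln N)^4)), and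
    (1 + ln N)^4 = o(exp (2 sqrt (ln N))). *)

(** * Estimates for the complex gaussian law *)

Section gauss.
Context {R : realType}.
Notation mu := (@lebesgue_measure R).

Definition gauss_pdf (z : R * R) : R := pi^-1 * expR (- (z.1 ^+ 2 + z.2 ^+ 2)).

Lemma gauss_pdf_ge0 z : 0 <= gauss_pdf z.
Proof. by rewrite mulr_ge0 ?expR_ge0 // invr_ge0 pi_ge0. Qed.

Lemma measurable_gauss_pdf : measurable_fun setT gauss_pdf.
Proof.
apply: measurable_funM => //; apply: measurableT_comp => //.
apply: measurableT_comp => //; apply: measurable_funD;
  apply: measurable_funX; [exact: measurable_fst|exact: measurable_snd].
Qed.

(** Only the part of the integral over a square of side [h] is kept, and the density is replaced
    there by its lower bound [m]. A unit square beyond the circle serves for [outside], a small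
    square at the origin for small discs. *)
Lemma gauss_box_le (A : set (R * R)) (a b h m : R) :
  measurable A -> 0 <= h -> 0 <= m ->
  (forall z, a <= z.1 <= a + h -> b <= z.2 <= b + h -> A z /\ m <= gauss_pdf z) ->
  ((m * h ^+ 2)%:E <= \int[mu \x mu]_(z in A) (gauss_pdf z)%:E)%E.
Proof.
move=> mA h0 m0 H.
pose B := `[a, a + h]%classic `*` `[b, b + h]%classic : set (R * R).
have mB : measurable B by apply: measurableX; exact: measurable_itv.
have HB z : B z -> A z /\ m <= gauss_pdf z.
  by move=> [/=]; rewrite !in_itv /= => ? ?; exact: H.
have mg D : measurable D -> measurable_fun D (fun z => (gauss_pdf z)%:E).
  move=> mD; apply/measurable_EFinP; apply: measurable_funS measurable_gauss_pdf => //.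
apply: (@le_trans _ _ (\int[mu \x mu]_(z in B) (gauss_pdf z)%:E)%E); last first.
  apply: ge0_subset_integral => //.
  - exact: mg.
  - by move=> z _; rewrite lee_fin gauss_pdf_ge0.
  - by move=> z /HB[].
apply: (@le_trans _ _ (\int[mu \x mu]_(z in B) m%:E)%E); last first.
  apply: ge0_le_integral => //.
  - exact: mg.
  - by move=> z /HB[]; rewrite lee_fin.
rewrite integral_cst// [X in (_ <= _ * X)%E](_ : _ = mu `[a, (a + h)%R] * mu `[b, (b + h)%R])%E; last by rewrite /B; apply: product_measure1E; exact: measurable_itv.
rewrite !lebesgue_measure_itv /= !lte_fin !ltrDl.
case: ltgtP h0 => // [h0|<-] _; last by rewrite expr0n /= mulr0 mul0e mule0.
by rewrite -!EFinB -!EFinM lee_fin expr2; lra.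
Qed.

Definition outside (k : R) : set (R * R) := [set z | k ^+ 2 < z.1 ^+ 2 + z.2 ^+ 2].
Definition disc (k : R) : set (R * R) := [set z | z.1 ^+ 2 + z.2 ^+ 2 <= k ^+ 2].

Lemma measurable_sqnorm : measurable_fun setT (fun z : R * R => z.1 ^+ 2 + z.2 ^+ 2).
Proof.
apply: measurable_funD;
  apply: measurable_funX; [exact: measurable_fst|exact: measurable_snd].
Qed.

Lemma measurable_outside k : measurable (outside k).
Proof.
rewrite (_ : outside k = (fun z : R * R => z.1 ^+ 2 + z.2 ^+ 2) @^-1` `]k ^+ 2, +oo[).
  by rewrite -[X in measurable X]setTI; apply: measurable_sqnorm => //; exact: measurable_itv.
by apply/seteqP; split=> z /=; rewrite in_itv /= andbT.
Qed.

Lemma setC_disc k : ~` disc k = outside k.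
Proof. by apply/seteqP; split=> z; rewrite /disc /outside /= ltNge => /negP. Qed.

Lemma measurable_disc k : measurable (disc k).
Proof. by rewrite -[disc k]setCK setC_disc; apply: measurableC; exact: measurable_outside. Qed.

(* exp (-|z|^2) <= exp (- l^2 / 2) exp (-|z|^2 / 2) for |z| > l, and the last factor
   is 2 pi times a product of two standard normal densities. *)
Lemma gauss_outside_le (l : R) : 
  (\int[mu \x mu]_(z in outside l) (gauss_pdf z)%:E <= (2 * expR (- (l ^+ 2 / 2)))%:E)%E.
Proof.
pose c := 2 * expR (- (l ^+ 2 / 2)) : R.
have c0 : 0 <= c by rewrite mulr_ge0 ?expR_ge0.
pose f (x : R) := normal_pdf 0 1 x : R.
have f0 x : 0 <= f x by exact: normal_pdf_ge0.
have mf : measurable_fun setT f by exact: measurable_normal_pdf.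
have mff : measurable_fun setT (fun z : R * R => (f z.1 * f z.2)%:E).
  apply/measurable_EFinP; apply: measurable_funM; apply: measurableT_comp => //.
have fE x y : f x * f y = (2 * pi)^-1 * expR (- ((x ^+ 2 + y ^+ 2) / 2)).
  rewrite /f !normal_pdfE ?oner_neq0// /normal_peak /normal_fun.
  rewrite mulrACA -invfM -expr2 sqr_sqrtr; last first.
    by rewrite mulrn_wge0// mulr_ge0 ?pi_ge0 ?sqr_ge0.
  rewrite -expRD; congr (_ * expR _); rewrite ?expr1n ?mul1r ?mulr_natl//.
  by field.
apply: (@le_trans _ _ (\int[mu \x mu]_(z in outside l) (c%:E * (f z.1 * f z.2)%:E))%E).
  apply: ge0_le_integral.
  - exact: measurable_outside.
  - by move=> z _; rewrite lee_fin gauss_pdf_ge0.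
  - apply/measurable_EFinP; apply: measurable_funS measurable_gauss_pdf => //.
  - apply/measurable_EFinP; apply: measurable_funM => //.
    by move/measurable_EFinP : mff; exact: measurable_funS.
  - move=> [x y]; rewrite /outside /= => hz; rewrite -EFinM lee_fin fE /c /gauss_pdf /=.
    have -> : (2 * expR (- (l ^+ 2 / 2))) * ((2 * pi)^-1 * expR (- ((x ^+ 2 + y ^+ 2) / 2)))
       = pi^-1 * expR (- (l ^+ 2 / 2) - (x ^+ 2 + y ^+ 2) / 2).
      rewrite expRD; have := @pi_gt0 R => ?; field; lra.
    rewrite ler_wpM2l ?invr_ge0 ?pi_ge0// ler_expR; lra.
apply: (@le_trans _ _ (\int[mu \x mu]_z (c%:E * (f z.1 * f z.2)%:E))%E).
  apply: ge0_subset_integral => //.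
  - exact: measurable_outside.
  - apply/measurable_EFinP; apply: measurable_funM => //.
    by move/measurable_EFinP : mff.
  - by move=> z _; rewrite -EFinM lee_fin !mulr_ge0.
rewrite ge0_integralZl//; last by move=> z _; rewrite lee_fin mulr_ge0.
rewrite fubini_tonelli1//; last by move=> z; rewrite lee_fin mulr_ge0.
rewrite (_ : (\int[mu]_x _)%E = (\int[mu]_x (f x)%:E)%E).
  by rewrite integral_normal_pdf mule1.
apply: eq_integral => x _; rewrite /fubini_F /=.
under eq_integral do rewrite EFinM.
rewrite ge0_integralZl// ?integral_normal_pdf ?mule1//.
- by apply/measurable_EFinP.
- by move=> y _; rewrite lee_fin.
- by rewrite lee_fin.
Qed.

End gauss.

(** * Gaussian probabilities of discs and of their complements *)

Section gauss_prob.
Context {R : realType} {d : measure_display} {T : measurableType d}.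
Variable P : probability T R.
Notation mu := (@lebesgue_measure R).

(** The three bounds are the three regimes of the proof: a large constant coefficient, small discs
    around the dominant terms, and growing discs around the tail. [C] is chosen before [X] and [Y],
    so one constant serves every coefficient. *)
Lemma gauss_prob_bounds : exists C : R, 0 <= C /\
  forall X Y : T -> R, std_complex_gaussian P X Y ->
  [/\ forall k, 0 <= k ->
        ((expR (- (C * (k + 1) ^+ 2)))%:E <= P [set w | outside k (X w, Y w)])%E,
      forall k, 0 < k <= 1 ->
        ((expR (2 * ln k - C))%:E <= P [set w | disc k (X w, Y w)])%E &
      forall k, 1 <= k ->
        ((expR (- (C / k ^+ 2)))%:E <= P [set w | disc k (X w, Y w)])%E].
Proof.
have pi0 := @pi_gt0 R; have pi1 : 1 <= (pi : R) by have := @pi_ge2 R; lra.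
pose L : R := ln pi; have L0 : 0 <= L by rewrite ln_ge0.
have piE : pi^-1 = expR (- L) by rewrite expRN /L lnK.
have e3 : expR (- 3) <= 4^-1 :> R.
  rewrite expRN lef_pV2 ?posrE ?expR_gt0//; have := @expR_ge1Dx R 3; lra.
(* The term [L] pays for the factor [1 / pi], and the factor 8 matches the threshold [1 / 8] put on
   [k ^- 2] in the third bound. *)
exists (8 * (L + 5)); split; first lra.
move=> X Y [mX [mY HP]].
have mXY : measurable_fun setT (fun w => (X w, Y w)) by exact: measurable_fun_pair.
have mpre A : measurable A -> measurable [set w | A (X w, Y w)].
  by move=> mA; rewrite -[X in measurable X]setTI; exact: mXY.
(* The square [[0, k/2]^2] lies in the disc and has [|z|^2 <= 1] on it. Its area [k^2 / 4] explains
   [e3]: the factor [1 / 4] is absorbed by [exp (-3)]. *)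
have small k : 0 < k <= 1 ->
    ((expR (2 * ln k - (L + 4)))%:E <= P [set w | disc k (X w, Y w)])%E.
  move=> /andP[k0 k1]; rewrite HP; last exact: measurable_disc.
  apply: le_trans (@gauss_box_le R (disc k) 0 0 (k / 2) (pi^-1 * expR (- 1)) _ _ _ _).
  - have -> : expR (2 * ln k - (L + 4)) = k ^+ 2 * (expR (- L) * expR (- 1) * expR (- 3)).
      have e2 : expR (2 * ln k) = k ^+ 2.
        by rewrite mulr2n mulrDl mul1r expRD lnK ?posrE// expr2.
      by rewrite -e2 -!expRD; congr expR; lra.
    rewrite lee_fin piE expr_div_n.
    have : expR (- L) * expR (- 1) * expR (- 3) <= expR (- L) * expR (- 1) * 4^-1 :> R.
      by rewrite ler_wpM2l// mulr_ge0 ?expR_ge0.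
    have := sqr_ge0 k; nra.
  - exact: measurable_disc.
  - lra.
  - by rewrite mulr_ge0 ?expR_ge0// invr_ge0 ltW.
  - move=> [x y] /= /andP[x0 xk] /andP[y0 yk].
    have xx : x ^+ 2 <= (k / 2) ^+ 2 by rewrite ler_sqr ?nnegrE; lra.
    have yy : y ^+ 2 <= (k / 2) ^+ 2 by rewrite ler_sqr ?nnegrE; lra.
    have k2 : k ^+ 2 <= 1 by rewrite expr_le1// ltW.
    split; first by rewrite /disc /=; nra.
    rewrite /gauss_pdf ler_wpM2l ?invr_ge0 ?(ltW pi0)// ler_expR /=.
    by rewrite expr_div_n in xx yy; lra.
split.
- move=> k k0; rewrite HP; last exact: measurable_outside.
  apply: le_trans (@gauss_box_le R (outside k) (k + 1) 0 1
    (pi^-1 * expR (- ((k + 2) ^+ 2 + 1))) _ _ _ _).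
  + rewrite lee_fin expr1n mulr1 piE -expRD ler_expR; nra.
  + exact: measurable_outside.
  + by [].
  + by rewrite mulr_ge0 ?expR_ge0// invr_ge0 ltW.
  + move=> [x y] /= /andP[x0 xk] /andP[y0 yk].
    have x2 : (k + 1) ^+ 2 <= x ^+ 2 by rewrite ler_sqr ?nnegrE; lra.
    have x3 : x ^+ 2 <= (k + 2) ^+ 2 by rewrite ler_sqr ?nnegrE; lra.
    have y2 : y ^+ 2 <= 1 by rewrite expr_le1//; lra.
    have y3 := sqr_ge0 y.
    split; first by rewrite /outside /=; nra.
    rewrite /gauss_pdf ler_wpM2l ?invr_ge0 ?(ltW pi0)// ler_expR /=; lra.
- move=> k k01; apply: le_trans (small k k01); rewrite lee_fin ler_expR; lra.
- move=> k k1; pose u := (k ^+ 2)^-1.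
  have kk : 1 <= k ^+ 2 by rewrite exprn_ege1.
  have u0 : 0 < u by rewrite invr_gt0; lra.
  (* If [k^2 < 8], the unit disc is already likely enough. Otherwise the complement has probability
     at most [4 u], because [2 exp (- k^2 / 2) <= 2 / (1 + k^2 / 2)]. *)
  have [u8|u8] := leP u 8^-1; last first.
    apply: (@le_trans _ _ (P [set w | disc 1 (X w, Y w)])); last first.
      apply: le_measure; rewrite ?inE; try (by apply: mpre; exact: measurable_disc).
      by move=> w; rewrite /disc /= expr1n => /le_trans; apply.
    apply: le_trans (small 1 _); last by rewrite ltr01 lexx.
    by rewrite ln1 lee_fin ler_expR -/u; nra.
  have -> : [set w | disc k (X w, Y w)] = ~` [set w | outside k (X w, Y w)].
    by rewrite -[disc k]setCK setC_disc.
  rewrite probability_setC; last by apply: mpre; exact: measurable_outside.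
  have : (P [set w | outside k (X w, Y w)] <= (4 * u)%:E)%E.
    rewrite HP; last exact: measurable_outside.
    apply: le_trans (gauss_outside_le k) _.
    rewrite lee_fin expRN.
    have h := @expR_ge1Dx R (k ^+ 2 / 2).
    rewrite -[leRHS]mulr1 ler_pdivrMr ?expR_gt0//.
    have := ler_wpM2l (ltW u0) h; rewrite mulrDr mulrA /u mulVf; last by lra.
    rewrite -/u; lra.
  have : P [set w | outside k (X w, Y w)] \is a fin_num by rewrite fin_num_measure//; by apply: mpre; exact: measurable_outside.
  case: (P _) => // p _; rewrite !lee_fin => pu.
  rewrite -/u expRN invf_ple ?posrE ?expR_gt0//; last lra.
  apply: le_trans (_ : 1 + (8 * (L + 5)) * u <= _); last exact: expR_ge1Dx.
  (* Expanding gives [1 + 4 u - 32 u^2], which is at least 1 exactly because [0 < u <= 1 / 8]. *)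
  have h1 : 1 <= (1 + 8 * u) * (1 - 4 * u) by nra.
  have h2 : (1 + 8 * u) * (1 - 4 * u) <= (1 + 8 * (L + 5) * u) * (1 - p).
    have Lu : 0 <= L * u by rewrite mulr_ge0// ltW.
    by apply: ler_pM; lra.
  have q0 : 0 < 1 - p by lra.
  by rewrite -[leLHS]mul1r ler_pdivrMr// (le_trans h1).
Qed.

End gauss_prob.

(** * The summable gaps *)

Section radii.
Context {R : realType}.

(* Summable by telescoping, while [1 / gap j] exceeds [j] only by a logarithmic factor. *)
Definition gap (j : nat) : R := (1 + ln j.+1%:R)^-1 - (1 + ln j.+2%:R)^-1.

Let lnS_ge0 j : 0 <= ln j.+1%:R :> R.
Proof. by rewrite ln_ge0// ler1n. Qed.

(** Over a common denominator the gap is [(ln (y + 1) - ln y) / ((1 + ln y) (1 + ln (y + 1)))] with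
    [y = j + 1]. The numerator is at least [1 / (y + 1)], by [ln (1 + x) <= x] at
    [x = - 1 / (y + 1)]. *)
Lemma gap_ge j : (j.+2%:R * (1 + ln j.+2%:R) ^+ 2)^-1 <= gap j.
Proof.
have l1 := lnS_ge0 j; have l2 := lnS_ge0 j.+1.
pose y : R := j.+1%:R; have y0 : 0 < y by rewrite ltr0n.
have yE : j.+2%:R = y + 1 :> R by rewrite /y -addn1 natrD.
have ly0 : 0 <= ln y by [].
have ly1 : ln y <= ln (y + 1) by rewrite ler_ln ?posrE; lra.
have d1 : (y + 1)^-1 <= ln (y + 1) - ln y.
  have : ln (y / (y + 1)) <= y / (y + 1) - 1.
    have -> : y / (y + 1) = 1 + - (y + 1)^-1 by field; lra.
    rewrite [leRHS]addrAC subrr add0r; apply: le_ln1Dx.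
    by rewrite ltrN2 invf_lt1; lra.
  rewrite ln_div ?posrE; try lra.
  have -> : y / (y + 1) - 1 = - (y + 1)^-1 by field; lra.
  lra.
rewrite /gap yE -/y; set a := ln y in ly0 ly1 d1 *; set b := ln (y + 1) in ly1 d1 *.
have -> : (1 + a)^-1 - (1 + b)^-1 = (b - a) / ((1 + a) * (1 + b)) by field; lra.
rewrite invfM; apply: ler_pM => //.
- by rewrite invr_ge0; lra.
- by rewrite invr_ge0 sqr_ge0.
- by rewrite lef_pV2 ?posrE; nra.
Qed.

Lemma gap_gt0 j : 0 < gap j.
Proof.
apply: lt_le_trans (gap_ge j); rewrite invr_gt0 mulr_gt0 ?ltr0n//.
by rewrite exprn_gt0//; have := lnS_ge0 j.+1; lra.
Qed.

Lemma gapV_le j : (gap j)^-1 <= j.+2%:R * (1 + ln j.+2%:R) ^+ 2.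
Proof.
rewrite invf_ple ?posrE ?gap_gt0 ?gap_ge// mulr_gt0 ?ltr0n//.
by rewrite exprn_gt0//; have := lnS_ge0 j.+1; lra.
Qed.

Lemma gap_le1 j : gap j <= 1.
Proof.
have l1 := lnS_ge0 j; have l2 := lnS_ge0 j.+1.
have : (1 + ln j.+1%:R)^-1 <= 1 :> R by rewrite invf_le1; lra.
have : 0 <= (1 + ln j.+2%:R)^-1 :> R by rewrite invr_ge0; lra.
rewrite /gap; lra.
Qed.

Lemma sum_gap_le1 M : \sum_(j < M) gap j <= 1.
Proof.
suff -> : \sum_(j < M) gap j = 1 - (1 + ln M.+1%:R)^-1.
  by rewrite gerBl invr_ge0; have := lnS_ge0 M; lra.
elim: M => [|M IH]; first by rewrite big_ord0 ln1 addr0 invr1 subrr.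
by rewrite big_ord_recr /= IH /gap; lra.
Qed.

(** Writing [exp (2 x)] as the ninth power of [exp (2 x / 9) >= (1 + x) / 9] gives growth of degree
    9 against degree 8 on the left. The remaining factor [1 + x] dominates [9^9 |D|] beyond the
    threshold. *)
Lemma poly_log_le_expR (D : R) : exists x0 : R, 0 <= x0 /\
  forall x, x0 <= x -> D * (1 + x ^+ 2) ^+ 4 <= expR (2 * x).
Proof.
exists (1 + 9 ^+ 9 * `|D|); split; first by rewrite addr_ge0// mulr_ge0.
move=> x hx.
have D0 := normr_ge0 D.
have x0 : 1 <= x by apply: le_trans hx; rewrite lerDl mulr_ge0.
have h1 : (1 + x ^+ 2) ^+ 4 <= (1 + x) ^+ 8.
  have -> : (1 + x) ^+ 8 = ((1 + x) ^+ 2) ^+ 4 by rewrite -exprM.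
  by rewrite lerXn2r ?nnegrE//; nra.
have h2 : expR (2 * x) = expR (2 * x / 9) ^+ 9.
  by rewrite -expRM_natl; congr expR; field.
have h3 : ((1 + x) / 9) ^+ 9 <= expR (2 * x / 9) ^+ 9.
  have h := @expR_ge1Dx R (2 * x / 9).
  by rewrite lerXn2r ?nnegrE ?expR_ge0//; lra.
rewrite h2; apply: le_trans h3.
rewrite expr_div_n [(1 + x) ^+ 9]exprSr; move: hx; set c : R := 9 ^+ 9 => hx.
have c0 : 0 < c by rewrite exprn_gt0.
rewrite ler_pdivlMr//; set p := (1 + x) ^+ 8 in h1 *; set q := (1 + x ^+ 2) ^+ 4 in h1 *.
have q0 : 0 <= q by rewrite exprn_ge0// addr_ge0// sqr_ge0.
apply: (@le_trans _ _ (q * (c * `|D|))).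
  rewrite (_ : D * q * c = q * c * D); last by ring.
  by rewrite [leRHS]mulrA ler_wpM2l ?ler_norm// mulr_ge0// ltW.
by apply: ler_pM => //; [rewrite mulr_ge0// ltW|lra].
Qed.

(** Each of the four costs is at most a constant times [W^2 = N (1 + ln N)^4]. The sum [D] of these
    constants is then absorbed by [poly_log_le_expR] at [x = sqrt (ln N)]. *)
Lemma cost_le (C A eps : R) : 0 <= C -> 0 <= A -> 0 < eps ->
  exists N0 : nat, forall N j : nat, (N0 <= N)%N -> (j ^ 2 <= N)%N ->
  let K := 1 + j.*2.+1%:R + (gap j)^-1 in
  C * (K * A + 1) ^+ 2 + N%:R * (C + 2 * ln N%:R) + C * j.*2.+1%:R + C / gap j
  <= N%:R * expR ((2 + eps) * Num.sqrt (ln N%:R)).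
Proof.
move=> C0 A0 e0.
pose D : R := C * (31 * A + 1) ^+ 2 + (C + 2) + 3 * C + 27 * C.
have [x0 [x00 Hx]] := poly_log_le_expR D.
(* From this index on [ln N >= x0^2], that is, [sqrt (ln N) >= x0]. *)
exists (Num.truncn (expR (x0 ^+ 2))).+1 => N j hN hj; cbv zeta.
set K := 1 + _ + _.
have nx : expR (x0 ^+ 2) <= N%:R :> R.
  have /andP[_ h] := truncn_itv (expR_ge0 (x0 ^+ 2)).
  by apply/ltW/(lt_le_trans h); rewrite ler_nat.
set n : R := N%:R in nx *.
have n1 : 1 <= n by apply: le_trans nx; have := @expR_ge1Dx R (x0 ^+ 2); have := sqr_ge0 x0; lra.
have n0 : 0 < n by lra.
set L := ln n; have Lx : x0 ^+ 2 <= L.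
  by rewrite -[leLHS]expRK ler_ln ?posrE ?expR_gt0.
have L0 : 0 <= L by rewrite ln_ge0.
set x := Num.sqrt L.
have xL : x ^+ 2 = L by rewrite sqr_sqrtr.
have xx : x0 <= x by rewrite -[leLHS]ger0_norm// -sqrtr_sqr ler_wsqrtr.
have {}Hx := Hx x xx; rewrite xL in Hx.
pose s := Num.sqrt n; have s2 : s ^+ 2 = n by rewrite sqr_sqrtr// ltW.
have s1 : 1 <= s by rewrite -[leLHS](@sqrtr1 R) ler_wsqrtr.
have sn : s <= n by rewrite -s2 expr2 ler_peMr; lra.
have js : j%:R <= s.
  rewrite -[leLHS]ger0_norm// -sqrtr_sqr ler_wsqrtr// -natrX ler_nat//.
have j0 : 0 <= j%:R :> R by [].
have j2 : j.+2%:R = j%:R + 2 :> R by rewrite -addn2 natrD.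
have jd : j.*2.+1%:R = 2 * j%:R + 1 :> R by rewrite -addn1 natrD -mul2n natrM.
pose B := 1 + L; have B1 : 1 <= B by rewrite lerDl.
have lB : 1 + ln j.+2%:R <= 3 * B.
  have : ln j.+2%:R <= ln (3 * n) by rewrite ler_ln ?posrE ?j2; lra.
  have : ln 3 <= 2 :> R.
    have -> : 3 = 1 + 2 :> R by lra.
    by apply: le_ln1Dx; lra.
  rewrite lnM ?posrE// -/L /B; lra.
have l0 : 0 <= ln j.+2%:R :> R by rewrite ln_ge0// ler1n.
(* The constant is [3 * 3^2], from [j + 2 <= 3 s] and [1 + ln (j + 2) <= 3 B]. With it,
   [31 = 1 + 3 + 27] bounds the three summands of [K]. *)
have gB : (gap j)^-1 <= 27 * (s * B ^+ 2).
  apply: le_trans (gapV_le j) _.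
  have : (1 + ln j.+2%:R) ^+ 2 <= (3 * B) ^+ 2 by rewrite lerXn2r ?nnegrE//; lra.
  have : j.+2%:R <= 3 * s by rewrite j2; lra.
  move=> h1 h2; have := ler_pM _ _ h1 h2 => /(_ (ler0n _ _) (sqr_ge0 _)).
  by rewrite exprMn; lra.
have B2 : 1 <= B ^+ 2 by rewrite exprn_ege1.
have sB : s <= s * B ^+ 2 by rewrite ler_peMr//; lra.
have g0 : 0 <= (gap j)^-1 by rewrite invr_ge0 ltW// gap_gt0.
have KB : K <= 31 * (s * B ^+ 2) by rewrite /K jd; lra.
have K0 : 0 <= K by rewrite /K jd; lra.
have nB : n * B ^+ 4 = (s * B ^+ 2) ^+ 2 by rewrite exprMn -exprM s2.
set W := s * B ^+ 2 in gB sB KB nB.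
have W1 : 1 <= W by lra.
have WW : W <= W ^+ 2 by rewrite expr2 ler_peMr//; lra.
have nW : n <= W ^+ 2 by rewrite -nB ler_peMr ?exprn_ege1// ltW.
have h1 : (K * A + 1) ^+ 2 <= (31 * A + 1) ^+ 2 * W ^+ 2.
  rewrite -exprMn lerXn2r ?nnegrE//.
  - by rewrite addr_ge0// mulr_ge0.
  - by rewrite mulr_ge0//; [rewrite addr_ge0// mulr_ge0|lra].
  - by have := ler_wpM2r A0 KB; nra.
have h2 : n * (C + 2 * L) <= (C + 2) * W ^+ 2.
  rewrite -nB mulrCA; apply: ler_wpM2l; first exact: ltW.
  have hB : B <= B ^+ 4 by rewrite exprS ler_peMr ?exprn_ege1//; lra.
  have C2 : 0 <= C + 2 by lra.
  have := ler_wpM2l C2 hB; have := mulr_ge0 C0 L0; rewrite /B; lra.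
have h3 : C * j.*2.+1%:R <= 3 * C * W ^+ 2.
  have h : j.*2.+1%:R <= 3 * W ^+ 2 by rewrite jd; lra.
  by have := ler_wpM2l C0 h; lra.
have h4 : C / gap j <= 27 * C * W ^+ 2.
  have h : (gap j)^-1 <= 27 * W ^+ 2 by lra.
  by have := ler_wpM2l C0 h; lra.
have h5 := ler_wpM2l C0 h1.
apply: (@le_trans _ _ (D * W ^+ 2)); first by rewrite /D; lra.
rewrite -nB mulrCA; apply: ler_wpM2l; first exact: ltW.
apply: le_trans Hx _.
rewrite ler_expR ler_wpM2r ?sqrtr_ge0//; lra.
Qed.

End radii.

(** * Logarithmic measure and independence *)

Section log_measure.
Context {R : realType}.
Notation mu := (@lebesgue_measure R).

(** On [[l j, u j]] the integrand is at most [1 / l j], so that interval contributes at most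
    [u j / l j - 1]. The pieces are made disjoint by [seqDU], which turns the integral over the
    union into a series. *)
Lemma finite_log_measure_bigcup (l u : nat -> R) (S : R) :
  (forall j, 0 < l j <= u j) ->
  (forall M, \sum_(j < M) (u j / l j - 1) <= S) ->
  finite_log_measure (`]1, +oo[%classic `&` \bigcup_j `[l j, u j]%classic).
Proof.
move=> lu HS.
pose F j : set R := `[l j, u j]%classic `&` `]1, +oo[%classic.
have mF j : measurable (F j) by apply: measurableI; exact: measurable_itv.
have -> : `]1, +oo[%classic `&` \bigcup_j `[l j, u j]%classic = \bigcup_j F j :> set R.
  by rewrite setIC setI_bigcupl.
have minv (D : set R) : measurable D -> D `<=` `]1, +oo[ -> measurable_fun D (fun x : R => (x^-1)%:E).
  move=> mD D1; apply/measurable_EFinP; apply: measurable_funS D1 _; first exact: measurable_itv.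
  apply: open_continuous_measurable_fun; first exact: interval_open.
  move=> x; rewrite inE /= in_itv /= andbT => x1.
  by apply: inv_continuous; rewrite gt_eqF// (lt_trans ltr01).
have F1 j : F j `<=` `]1, +oo[ by exact: subIsetr.
have invge0 (D : set R) (x : R) : D `<=` `]1, +oo[ -> D x -> (0%:E <= (x^-1)%:E)%E.
  move=> D1 /D1; rewrite /= in_itv /= andbT => x1.
  by rewrite lee_fin invr_ge0 ltW// (lt_trans ltr01).
have F'1 j : seqDU F j `<=` `]1, +oo[ by apply: subset_trans (F1 j); exact: subset_seqDU.
split; first exact: bigcup_measurable.
have mF' j : measurable (seqDU F j) by exact: seqDU_measurable.
rewrite seqDU_bigcup_eq ge0_integral_bigcup//; last 2 first.
- apply: minv; first exact: bigcup_measurable.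
  by move=> x [j _]; exact: F'1.
- by move=> x [j _]; apply: invge0; exact: F'1.
apply: (@le_lt_trans _ _ S%:E); last exact: ltry.
have bd j : (\int[mu]_(x in seqDU F j) (x^-1)%:E <= (u j / l j - 1)%:E)%E.
  have /andP[l0 lej] := lu j.
  apply: (@le_trans _ _ (\int[mu]_(x in `[l j, u j]) ((l j)^-1)%:E)%E).
    apply: (@le_trans _ _ (\int[mu]_(x in seqDU F j) ((l j)^-1)%:E)%E).
      apply: ge0_le_integral => //.
      - exact: mF'.
      - by move=> x; exact: (invge0 _ _ (F'1 j)).
      - by apply: minv; [exact: mF'|exact: F'1].
      - move=> x /(@subset_seqDU _ F)[/=]; rewrite in_itv /= => /andP[lx _] _.
        by rewrite lee_fin lef_pV2// posrE// (lt_le_trans l0).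
    apply: ge0_subset_integral => //; first exact: mF'.
    - by move=> x _; rewrite lee_fin invr_ge0 ltW.
    - by move=> x /(@subset_seqDU _ F)[].
  rewrite integral_cst//= lebesgue_measure_itv /= lte_fin.
  case: ifPn => [_|].
    by rewrite -EFinB -EFinM lee_fin mulrBr mulVf ?gt_eqF// mulrC.
  by rewrite -leNgt mule0 lee_fin subr_ge0 ler_pdivlMr// mul1r.
apply: lime_le; first by apply: is_cvg_nneseries => n _ _; apply: integral_ge0 => x; exact: (invge0 _ _ (F'1 n)).
near=> M.
apply: (@le_trans _ _ (\sum_(0 <= j < M) (u j / l j - 1)%:E)%E); first exact: lee_sum.
by rewrite sumEFin lee_fin big_mkord.
Unshelve. all: by end_near.
Qed.

End log_measure.

Section independence.
Context {R : realType} {d : measure_display} {T : measurableType d}.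
Variable P : probability T R.

(** Independence speaks of finite families only. It gives the bound for each finite intersection
    [G M], and continuity of [P] along this decreasing sequence carries it to the limit. *)
Lemma prob_bigcap_ge (X Y : nat -> T -> R) (A : nat -> set (R * R)) (w : nat -> R) (W : R) :
  (forall n, measurable_fun setT (X n)) -> (forall n, measurable_fun setT (Y n)) ->
  mutually_independent P X Y -> (forall n, measurable (A n)) ->
  (forall n, ((expR (- w n))%:E <= P [set v | A n (X n v, Y n v)])%E) ->
  (forall M, \sum_(n < M) w n <= W) ->
  ((expR (- W))%:E <= P (\bigcap_n [set v | A n (X n v, Y n v)]))%E.
Proof.
move=> mX mY ind mA Hw HW.
pose B n := [set v | A n (X n v, Y n v)].
have mB n : measurable (B n).
  rewrite -[X in measurable X]setTI; apply: measurable_fun_pair => //.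
pose G M := \bigcap_(i in [set` iota 0 M]) B i.
have mG M : measurable (G M) by apply: bigcap_measurableType.
have -> : \bigcap_n B n = \bigcap_M G M.
  apply/seteqP; split=> [v Hv M _ i _|v Hv n _]; first exact: Hv.
  apply: (Hv n.+1 I n); change (is_true (n \in iota 0 n.+1)).
  by rewrite mem_iota leq0n add0n ltnS leqnn.
have GM M : ((expR (- W))%:E <= P (G M))%E.
  rewrite /G ind ?iota_uniq//.
  apply: (@le_trans _ _ (\big[*%E/1%E]_(i <- iota 0 M) (expR (- w i))%:E)%E).
    rewrite (_ : (\big[_/_]_(i <- _) _)%E = (\prod_(i <- iota 0 M) expR (- w i))%:E); last first.
      by elim/big_rec2 : _ => [//|i x y _ ->]; rewrite EFinM.
    rewrite -expR_sum lee_fin ler_expR sumrN lerN2.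
    by rewrite (_ : iota 0 M = index_iota 0 M) ?big_mkord// /index_iota subn0.
  suff [] : (0 <= \big[*%E/1%E]_(i <- iota 0 M) (expR (- w i))%:E)%E /\
      (\big[*%E/1%E]_(i <- iota 0 M) (expR (- w i))%:E <=
       \big[*%E/1%E]_(i <- iota 0 M) P (B i))%E by [].
  elim: (iota 0 M) => [|i s [h1 h2]]; first by rewrite !big_nil lee01 lexx.
  have wi : (0 <= (expR (- w i))%:E)%E by rewrite lee_fin expR_ge0.
  by rewrite !big_cons; split; [exact: mule_ge0|exact: lee_pmul].
have cv : (P \o G) x @[x --> \oo] --> P (\bigcap_n G n).
  apply: nonincreasing_cvg_mu => //.
  - by rewrite (le_lt_trans (probability_le1 _ _))// ltry.
  - exact: bigcapT_measurable.
  - move=> n m nm; apply/subsetPset => v Hv i /= hi; apply: Hv => /=.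
    by move: hi; rewrite !mem_iota /= !add0n => /leq_trans; apply.
rewrite -(cvg_lim _ cv)//; apply: lime_ge; first by apply/cvg_ex; eexists; exact: cv.
by near=> M; exact: GM.
Unshelve. all: by end_near.
Qed.

End independence.

(** * Power series without zeros in a disc *)

Section complex_modulus.
Context {R : realType}.
Implicit Types (x y z : R[i]) (c u s : nat -> R[i]).

Lemma normc_ge0 x : 0 <= normc x.
Proof. by case: x => a b; exact: sqrtr_ge0. Qed.

Lemma normc_add_le x y : normc (x + y) <= normc x + normc y.
Proof. exact: le_normcD. Qed.

Lemma normc_opp x : normc (- x) = normc x.
Proof. exact: normcN. Qed.

Lemma normc_distC x y : normc (x - y) = normc (y - x).
Proof. by rewrite -normc_opp opprB. Qed.

Lemma normc_le_dist x y : normc x <= normc y + normc (x - y).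
Proof. by rewrite -[x in leLHS](subrKC y); exact: normc_add_le. Qed.

Lemma normc_exp x n : normc (x ^+ n) = normc x ^+ n.
Proof.
elim: n => [|n IH]; first exact: ComplexField.Normc.normc1.
by rewrite !exprS ComplexField.Normc.normcM IH.
Qed.

Lemma normc_real (t : R) : 0 <= t -> normc (t%:C)%C = t.
Proof. by move=> t0; rewrite /= expr0n addr0 sqrtr_sqr ger0_norm. Qed.

Lemma normc_gt0 x : x != 0 -> 0 < normc x.
Proof.
move=> x0; rewrite lt_neqAle normc_ge0 andbT eq_sym.
by apply: contra_neq x0; exact: ComplexField.Normc.eq0_normc.
Qed.

Lemma normc_sum_le u (m n : nat) :
  normc (\sum_(m <= i < n) u i) <= \sum_(m <= i < n) normc (u i).
Proof.
elim/big_ind2 : _ => [|x1 x2 y1 y2 h1 h2|//].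
  by rewrite ComplexField.Normc.normc0.
by apply: le_trans (normc_add_le _ _) _; exact: lerD.
Qed.

Lemma normr_Re_le x : `|complex.Re x| <= normc x.
Proof.
by case: x => a b /=; rewrite -sqrtr_sqr ler_wsqrtr// lerDl sqr_ge0.
Qed.

Lemma normr_Im_le x : `|complex.Im x| <= normc x.
Proof.
by case: x => a b /=; rewrite -sqrtr_sqr ler_wsqrtr// lerDr sqr_ge0.
Qed.

Lemma normc_le_ReIm x : normc x <= `|complex.Re x| + `|complex.Im x|.
Proof.
case: x => a b /=; rewrite -[leRHS]ger0_norm ?addr_ge0// -sqrtr_sqr ler_wsqrtr//.
rewrite sqrrD !real_normK ?num_real//.
have : 0 <= `|a| * `|b| by rewrite mulr_ge0.
by lra.
Qed.

Lemma cvg_normcP s l : (fun N => normc (s N - l)) @ \oo --> (0 : R) <->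
  forall e, 0 < e -> exists N0, forall N, (N0 <= N)%N -> normc (s N - l) < e.
Proof.
split=> [/cvgrPdist_lt H e e0|H].
  have [N0 _ HN] := H e e0; exists N0 => N hN.
  by have := HN N hN; rewrite sub0r normrN ger0_norm// normc_ge0.
apply/cvgrPdist_lt => e e0; have [N0 HN] := H e e0.
by exists N0 => // N /HN; rewrite sub0r normrN ger0_norm// normc_ge0.
Qed.

(** Real and imaginary parts are dominated by the moduli, so each converges absolutely as a real
    series. *)
Lemma abs_summable_cvg u (K : R) : (forall M, \sum_(0 <= n < M) normc (u n) <= K) ->
  exists l, (fun N => normc (\sum_(n < N) u n - l)) @ \oo --> (0 : R).
Proof.
move=> HK.
have real_cvg (v : R ^nat) : (forall n, `|v n| <= normc (u n)) -> cvgn (series v).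
  move=> hv; apply: normed_cvg; apply: nondecreasing_is_cvgn.
    by apply: nondecreasing_series => n _ _; exact: normr_ge0.
  exists K => _ [M _ <-]; apply: le_trans (HK M); rewrite /series /=.
  exact: ler_sum.
have cR := real_cvg _ (fun n => normr_Re_le (u n)).
have cI := real_cvg _ (fun n => normr_Im_le (u n)).
set v1 := series _ in cR; set v2 := series _ in cI.
have SE N : \sum_(n < N) u n = (v1 N +i* v2 N)%C.
  rewrite /v1 /v2 /series /= !big_mkord.
  elim: N => [|N IH]; first by rewrite !big_ord0.
  by rewrite !big_ord_recr /= IH; case: (u N).
exists (limn v1 +i* limn v2)%C.
apply/cvg_normcP => e e0.
have e2 : 0 < e / 2 by rewrite divr_gt0.
move/cvgrPdist_lt : cR => /(_ _ e2) [N1 _ H1].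
move/cvgrPdist_lt : cI => /(_ _ e2) [N2 _ H2].
exists (maxn N1 N2) => N; rewrite geq_max => /andP[h1 h2].
apply: le_lt_trans (normc_le_ReIm _) _; rewrite SE /=.
have := H1 N h1; have := H2 N h2; rewrite /= ![`|limn _ - _|]distrC; lra.
Qed.

End complex_modulus.

(** * Convergence, tails and limits of complex power series *)

Section power_series.
Context {R : realType}.
Implicit Types (z l : R[i]) (c : nat -> R[i]).

(* With [c n := xi X Y n w * a n], [powsum c z] and [tends c z l] are convertible to
   [psum X Y a z w] and [f_is X Y a z w l]. *)
Definition powsum c z (N : nat) : R[i] := \sum_(n < N) c n * z ^+ n.

Definition tends c z l := (fun N => normc (powsum c z N - l)) @ \oo --> (0 : R).

Lemma normc_term_le c z n (t : R) : normc z <= t -> normc (c n * z ^+ n) <= normc (c n) * t ^+ n.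
Proof.
move=> zt; rewrite ComplexField.Normc.normcM normc_exp ler_wpM2l ?normc_ge0//.
by rewrite lerXn2r ?nnegrE ?normc_ge0// (le_trans (normc_ge0 z)).
Qed.

Lemma powsumB c z (m n : nat) : (m <= n)%N ->
  powsum c z n - powsum c z m = \sum_(m <= i < n) c i * z ^+ i.
Proof.
move=> mn; rewrite /powsum -!(big_mkord xpredT (fun i => c i * z ^+ i)).
by rewrite (big_cat_nat (leq0n m) mn) /= addrAC subrr add0r.
Qed.

Lemma tends_normc_ge c z l (e : R) (m : nat) : tends c z l ->
  (forall N, (m <= N)%N -> e <= normc (powsum c z N)) -> e <= normc l.
Proof.
move=> /cvg_normcP H He; apply/ler_addgt0Pr => x x0.
have [N0 HN] := H x x0.
have h1 := HN _ (leq_maxl N0 m); have h2 := He _ (leq_maxr N0 m).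
have := normc_le_dist (powsum c z (maxn N0 m)) l; lra.
Qed.

(** A term is a difference of consecutive partial sums, hence below 2 from [N0] on; the earlier
    terms are bounded by their sum. The bound is taken in [nat] so that it can later index a
    countable union. *)
Lemma tends_term_bounded c z l : tends c z l ->
  exists M : nat, forall n, normc (c n) * normc z ^+ n <= M%:R.
Proof.
move=> /cvg_normcP /(_ 1 ltr01) [N0 HN].
pose B : R := 2 + \sum_(0 <= i < N0) normc (c i) * normc z ^+ i.
have t0 n : 0 <= normc (c n) * normc z ^+ n.
  by rewrite mulr_ge0 ?exprn_ge0 ?normc_ge0.
exists (Num.truncn B).+1 => n; apply: (@le_trans _ _ B); last first.
  by apply/ltW/(truncnS_gt B).
have [nN|nN] := ltnP n N0.
  rewrite /B (big_rem n) /=; last by rewrite mem_index_iota.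
  have : 0 <= \sum_(y <- rem n (index_iota 0 N0)) normc (c y) * normc z ^+ y.
    exact: sumr_ge0.
  lra.
have := HN _ nN; have := HN _ (leqW nN); set p := powsum c z.
have : normc (c n) * normc z ^+ n <= normc (p n.+1 - l) + normc (p n - l).
  rewrite -normc_exp -ComplexField.Normc.normcM [normc (p n - l)]normc_distC.
  rewrite (_ : c n * z ^+ n = (p n.+1 - l) + (l - p n)); first exact: normc_add_le.
  by rewrite /p /powsum big_ord_recr /= addrA subrK addrAC subrr add0r.
have : 0 <= \sum_(0 <= i < N0) normc (c i) * normc z ^+ i by exact: sumr_ge0.
rewrite /B; lra.
Qed.

(** Comparison with the geometric series of ratio [t / rho]. The bound depends on the point only
    through [t], which makes it uniform on a disc. *)
Lemma tail_le c (t rho M : R) (m n : nat) : 0 <= t -> t < rho ->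
  (forall n, normc (c n) * rho ^+ n <= M) ->
  \sum_(m <= i < n) normc (c i) * t ^+ i <= M * (t / rho) ^+ m / (1 - t / rho).
Proof.
move=> t0 trho HM; have rho0 : 0 < rho by exact: le_lt_trans trho.
set q := t / rho.
have q0 : 0 <= q by rewrite divr_ge0// ltW.
have q1 : q < 1 by rewrite ltr_pdivrMr// mul1r.
have M0 : 0 <= M.
  by apply: le_trans (HM 0%N); rewrite mulr_ge0 ?normc_ge0// exprn_ge0// ltW.
apply: (@le_trans _ _ (\sum_(m <= i < n) M * q ^+ i)).
  apply: ler_sum => i _; rewrite (_ : t = rho * q); last by rewrite mulrC divfK ?gt_eqF.
  by rewrite exprMn mulrA ler_wpM2r// exprn_ge0.
rewrite -mulr_sumr -mulrA ler_wpM2l//.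
rewrite ler_pdivlMr ?subr_gt0//.
have [mn|mn] := leqP m n; last first.
  by rewrite big_geq ?mul0r ?exprn_ge0// ltnW.
have -> : (\sum_(m <= i < n) q ^+ i) * (1 - q) = q ^+ m - q ^+ n.
  elim: n mn => [|n IH]; first by rewrite leqn0 => /eqP->; rewrite big_geq// mul0r subrr.
  rewrite leq_eqVlt => /predU1P[->|]; first by rewrite big_geq// mul0r subrr.
  rewrite ltnS => mn; rewrite big_nat_recr//= mulrDl IH// exprS; ring.
by rewrite lerBlDr lerDl exprn_ge0.
Qed.

Lemma bounded_tends c z (rho M : R) : normc z < rho ->
  (forall n, normc (c n) * rho ^+ n <= M) -> exists l, tends c z l.
Proof.
move=> zrho HM.
apply: (@abs_summable_cvg _ (fun n => c n * z ^+ n)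
  (M * (normc z / rho) ^+ 0 / (1 - normc z / rho))) => n.
apply: le_trans (tail_le _ _ _ _ 0 n (normc_ge0 z) zrho HM).
by apply: ler_sum => i _; exact: normc_term_le.
Qed.

(** The constant term outweighs all the others together: every nonempty partial sum has modulus at
    least [|c_0| - K > 0], and this survives the limit. *)
Lemma dominated_nonvanishing c (r K : R) :
  (forall M, \sum_(1 <= n < M) normc (c n) * r ^+ n <= K) -> K < normc (c 0%N) ->
  forall z, normc z < r -> exists l, tends c z l /\ l != 0.
Proof.
move=> HK Kc z zr.
have sumle M : \sum_(1 <= n < M) normc (c n * z ^+ n) <= K.
  by apply: le_trans (HK M); apply: ler_sum => i _; apply: normc_term_le; exact: ltW.
have K0 : 0 <= K by have := HK 0%N; rewrite big_geq.
have [l Hl] : exists l, tends c z l.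
  apply: (@abs_summable_cvg _ (fun n => c n * z ^+ n) (normc (c 0%N) + K)) => -[|M].
    by rewrite big_geq// addr_ge0 ?normc_ge0.
  by rewrite big_ltn// expr0 mulr1 lerD2l.
exists l; split => //; apply/eqP => l0.
suff : normc (c 0%N) - K <= normc l.
  by rewrite l0 ComplexField.Normc.normc0; lra.
apply: (@tends_normc_ge _ _ _ _ 1 Hl) => N N1.
have E : powsum c z N - c 0%N = \sum_(1 <= i < N) c i * z ^+ i.
  by rewrite -powsumB// {3}/powsum big_ord_recr big_ord0 /= add0r mulr1.
have := normc_le_dist (c 0%N) (powsum c z N); rewrite normc_distC E.
have := normc_sum_le (fun i => c i * z ^+ i) 1 N; have := sumle N; lra.
Qed.

End power_series.

(** * Nonvanishing on an open disc as a countable condition on the coefficients *)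

Section disc_nonvanishing.
Context {R : realType}.
Implicit Types (z l : R[i]) (c : nat -> R[i]).

Definition cpx (p : R * R) : R[i] := (p.1 +i* p.2)%C.

Lemma cpx_ReIm z : cpx (complex.Re z, complex.Im z) = z.
Proof. by case: z. Qed.

(** Points are taken in [R * R] and values by coordinates, so that compactness of products of real
    segments applies. *)
Definition ccont (g : R * R -> R[i]) : Prop :=
  continuous (fun p => complex.Re (g p)) /\ continuous (fun p => complex.Im (g p)).

Lemma ccontD g h : ccont g -> ccont h -> ccont (fun p => g p + h p).
Proof.
move=> [g1 g2] [h1 h2]; split=> p.
  rewrite (_ : (fun p => _) = (fun p => complex.Re (g p) + complex.Re (h p))); last first.
    by apply/funext => x; case: (g x) => ? ?; case: (h x).
  by apply: cvgD; [exact: g1|exact: h1].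
rewrite (_ : (fun p => _) = (fun p => complex.Im (g p) + complex.Im (h p))); last first.
  by apply/funext => x; case: (g x) => ? ?; case: (h x).
by apply: cvgD; [exact: g2|exact: h2].
Qed.

Lemma ccontM g h : ccont g -> ccont h -> ccont (fun p => g p * h p).
Proof.
move=> [g1 g2] [h1 h2]; split=> p.
  rewrite (_ : (fun p => _) = (fun p => complex.Re (g p) * complex.Re (h p)
      - complex.Im (g p) * complex.Im (h p))); last first.
    by apply/funext => x; case: (g x) => ? ?; case: (h x).
  by apply: cvgB; apply: cvgM; [exact: g1|exact: h1|exact: g2|exact: h2].
rewrite (_ : (fun p => _) = (fun p => complex.Re (g p) * complex.Im (h p)
    + complex.Im (g p) * complex.Re (h p))); last first.
  by apply/funext => x; case: (g x) => ? ?; case: (h x).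
by apply: cvgD; apply: cvgM; [exact: g1|exact: h2|exact: g2|exact: h1].
Qed.

Lemma ccont_cst z : ccont (fun=> z).
Proof. by split=> p; exact: cvg_cst. Qed.

Lemma ccont_cpx : ccont cpx.
Proof. by split=> p; [exact: cvg_fst|exact: cvg_snd]. Qed.

Lemma ccont_powsum c N : ccont (fun p => powsum c (cpx p) N).
Proof.
elim: N => [|N IH].
  rewrite (_ : (fun _ => _) = (fun=> 0)); first exact: ccont_cst.
  by apply/funext => p; rewrite /powsum big_ord0.
rewrite (_ : (fun _ => _) = (fun p => powsum c (cpx p) N + c N * cpx p ^+ N)).
  apply: ccontD => //; apply: ccontM; first exact: ccont_cst.
  elim: N {IH} => [|N IH].
    by rewrite (_ : (fun _ => _) = (fun=> 1)); [exact: ccont_cst|exact/funext].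
  rewrite (_ : (fun _ => _) = (fun p => cpx p * cpx p ^+ N)).
    by apply: ccontM => //; exact: ccont_cpx.
  by apply/funext => p; rewrite exprS.
by apply/funext => p; rewrite /powsum big_ord_recr.
Qed.

Lemma normcE (x : R[i]) : normc x = Num.sqrt (complex.Re x ^+ 2 + complex.Im x ^+ 2).
Proof. by case: x. Qed.

Lemma continuous_normc g : ccont g -> continuous (fun p => normc (g p)).
Proof.
move=> [g1 g2] p.
rewrite (_ : (fun p => _) =
    Num.sqrt \o (fun p => complex.Re (g p) ^+ 2 + complex.Im (g p) ^+ 2)); last first.
  by apply/funext => x; rewrite normcE.
apply: continuous_comp; last exact: sqrt_continuous.
by apply: cvgD; apply: cvgM; [exact: g1|exact: g1|exact: g2|exact: g2].
Qed.

Lemma compact_disc (t : R) : compact [set p : R * R | normc (cpx p) <= t].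
Proof.
apply: (@subclosed_compact _ _ (`[- t, t]%classic `*` `[- t, t]%classic)).
- rewrite (_ : [set p | _] = (fun p => normc (cpx p)) @^-1` `]-oo, t]%classic); last first.
    by apply/seteqP; split => p /=; rewrite in_itv.
  apply: closed_comp; last exact: interval_closed.
  by move=> p _; apply: continuous_normc; exact: ccont_cpx.
- by apply: compact_setX; exact: segment_compact.
- move=> p /= pt; rewrite !in_itv /= -!ler_norml; split.
  + exact: le_trans (normr_Re_le (cpx p)) pt.
  + exact: le_trans (normr_Im_le (cpx p)) pt.
Qed.

(** At each point the limit is nonzero. Continuity of one partial sum and the uniform tail bound
    spread a lower bound to a neighbourhood and to all later partial sums. Compactness of the closed
    disc, in its near-covering form, then yields a single [m]. *)
Lemma disc_nonvanishing_uniform c (t rho M : R) : t < rho ->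
  (forall n, normc (c n) * rho ^+ n <= M) ->
  (forall z, normc z <= t -> exists l, tends c z l /\ l != 0) ->
  exists m : nat, forall N, (m <= N)%N -> forall z, normc z <= t ->
    m.+1%:R^-1 <= normc (powsum c z N).
Proof.
move=> trho HM Hz.
have [t0|t0] := ltP t 0.
  by exists 0%N => N _ z zt; have := normc_ge0 z; lra.
have rho0 : 0 < rho by lra.
set q := t / rho.
have q0 : 0 <= q by rewrite divr_ge0// ltW.
have q1 : q < 1 by rewrite ltr_pdivrMr// mul1r.
have tail0 e : 0 < e -> exists m, forall N, (m <= N)%N -> M * q ^+ N / (1 - q) < e.
  move=> e0.
  have : (fun N => M * q ^+ N / (1 - q)) @ \oo --> M * 0 / (1 - q).
    apply: cvgM; last exact: cvg_cst.
    by apply: cvgM; [exact: cvg_cst|apply: cvg_expr; rewrite ger0_norm].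
  rewrite mulr0 mul0r => /cvgrPdist_lt /(_ e e0) [m _ Hm].
  exists m => N /Hm /=; rewrite sub0r normrN => h; exact: le_lt_trans (ler_norm _) h.
have FF : Filter \oo by exact: _.
have /compact_near_coveringP := compact_disc t.
move=> /(_ nat \oo (fun i p => normc (cpx p) <= t -> forall N, (i <= N)%N ->
  i.+1%:R^-1 <= normc (powsum c (cpx p) N)) FF).
case.
  move=> p /Hz [l [Hl l0]].
  pose e : R := normc l; have e0 : 0 < e by exact: normc_gt0.
  (* Three errors below [b] occur: limit against partial sum at [p], the move from [p] to [p'], and
     the tail at [p']. Of [8 b] at least [5 b] remains, above [1 / (i + 1)]. *)
  have [b b0 be] : exists2 b : R, 0 < b & b * 8 = e by exists (e / 8); lra.
  have [m1 Hm1] := tail0 _ b0.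
  move/cvg_normcP : Hl => /(_ _ b0) [m2 Hm2].
  pose N1 := maxn m1 m2.
  have c1 := continuous_normc _ (ccont_powsum c N1) p.
  move/cvgrPdist_lt : c1 => /(_ _ b0) c1.
  have [m3 _ Hm3] := near_infty_natSinv_lt (PosNum b0).
  exists ([set p' | `|normc (powsum c (cpx p) N1) - normc (powsum c (cpx p') N1)| < b],
          [set i | (maxn N1 m3 <= i)%N]).
    by split => //=; exists (maxn N1 m3).
  move=> [p' i] [/= h1 h2] pt N iN.
  have [N1i m3i] : (N1 <= i)%N /\ (m3 <= i)%N by move: h2; rewrite geq_max => /andP[].
  have h3 := Hm2 N1 (leq_maxr _ _).
  have h4 := Hm1 N1 (leq_maxl _ _).
  have h5 := normc_le_dist l (powsum c (cpx p) N1).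
  rewrite normc_distC in h5.
  have h6 := normc_le_dist (powsum c (cpx p') N1) (powsum c (cpx p') N).
  rewrite normc_distC (powsumB _ _ _ _ (leq_trans N1i iN)) in h6.
  have h7 := normc_sum_le (fun i => c i * cpx p' ^+ i) N1 N.
  have h8 : \sum_(N1 <= i < N) normc (c i * cpx p' ^+ i) <= M * q ^+ N1 / (1 - q).
    apply: le_trans (tail_le _ _ _ _ N1 N t0 trho HM).
    by apply: ler_sum => j _; exact: normc_term_le.
  have h9 : (i.+1%:R^-1 : R) < b by exact: Hm3.
  move: h1; rewrite ltr_norml => /andP[h1 h1'].
  rewrite -/e in h5; have h10 := le_lt_trans (le_trans h7 h8) h4.
  apply: le_trans (ltW h9) _; lra.
move=> m _ Hm; exists m => N mN z zt.
have pz : normc (cpx (complex.Re z, complex.Im z)) <= t by rewrite cpx_ReIm.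
by have := Hm m (leqnn m) _ pz pz N mN; rewrite cpx_ReIm.
Qed.

(** A violation at [z] is an open condition, as is [normc z < t], so both would persist at a nearby
    rational point. *)
Lemma powsum_ge_of_rat c (t e : R) N :
  (forall p q : rat, normc (cpx (ratr p, ratr q)) < t ->
    e <= normc (powsum c (cpx (ratr p, ratr q)) N)) ->
  forall z, normc z < t -> e <= normc (powsum c z N).
Proof.
move=> H z zt; rewrite leNgt; apply/negP => ze.
pose p := (complex.Re z, complex.Im z).
have near_lt g (b : R) : ccont g -> normc (g p) < b -> \forall x \near p, normc (g x) < b.
  by move=> gc gb; have /cvgr_lt := continuous_normc _ gc p; exact.
have n1 := near_lt _ _ (ccont_powsum c N) _; rewrite cpx_ReIm in n1; have {}n1 := n1 _ ze.
have n2 := near_lt _ _ ccont_cpx _; rewrite cpx_ReIm in n2; have {}n2 := n2 _ zt.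
have : \forall x \near p, normc (powsum c (cpx x) N) < e /\ normc (cpx x) < t.
  exact: filterI n1 n2.
move=> /nbhs_ballP[d /= d0 Hd].
have [p1 hp1] : exists p1 : rat, ratr p1 \in `]p.1, (p.1 + d)[ by apply: rat_in_itvoo; rewrite ltrDl.
have [p2 hp2] : exists p2 : rat, ratr p2 \in `]p.2, (p.2 + d)[ by apply: rat_in_itvoo; rewrite ltrDl.
move: hp1 hp2; rewrite !in_itv /= => /andP[a1 b1] /andP[a2 b2].
have [] : normc (powsum c (cpx (ratr p1, ratr p2)) N) < e /\ normc (cpx (ratr p1, ratr p2)) < t.
  apply: Hd; split; rewrite /ball /= ltr_norml; apply/andP; rewrite /p /= in a1 b1 a2 b2 *; lra.
by move=> h1 /H; rewrite leNgt h1.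
Qed.

(** A strictly increasing sequence of radii exhausting the open disc; each closed disc is compact
    and has room up to the next radius. *)
Definition inner_radius (r : R) (k : nat) : R := r * (k.+1%:R / k.+2%:R).

Lemma inner_radius_bounds r k : 0 < r ->
  0 < inner_radius r k /\ inner_radius r k < inner_radius r k.+1 /\ inner_radius r k < r.
Proof.
move=> r0; rewrite /inner_radius.
have k0 : 0 <= k%:R :> R by [].
have -> : k.+1%:R = k%:R + 1 :> R by rewrite -addn1 natrD.
have -> : k.+2%:R = k%:R + 2 :> R by rewrite -addn2 natrD.
have -> : k.+3%:R = k%:R + 3 :> R by rewrite -addn3 natrD.
split; first by rewrite mulr_gt0// divr_gt0; lra.
split.
  rewrite ltr_pM2l// ltr_pdivrMr; last lra.
  by rewrite mulrAC ltr_pdivlMr; nra.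
by rewrite gtr_pMr// ltr_pdivrMr; lra.
Qed.

Lemma lt_inner_radius (x r : R) : 0 < r -> x < r -> exists k, x < inner_radius r k.
Proof.
move=> r0 xr; exists (Num.truncn (r / (r - x))).
set k := Num.truncn _.
have h : r / (r - x) < k.+1%:R by exact: truncnS_gt.
rewrite /inner_radius mulrA ltr_pdivlMr//.
have d0 : 0 < r - x by lra.
rewrite ltr_pdivrMr// in h.
have -> : k.+2%:R = k.+1%:R + 1 :> R by rewrite -addn1 natrD.
nra.
Qed.

(* The right-hand side involves countably many conditions on finitely many
   coefficients each, which makes the no-zero event measurable; without this [P] of
   the event would be a junk value. *)
Lemma nonvanishing_countable c (r : R) : 0 < r ->
  (forall z, normc z < r -> exists l, tends c z l /\ l != 0) <->
  (forall k : nat,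
     (exists M : nat, forall n, normc (c n) * inner_radius r k ^+ n <= M%:R) /\
     (exists m : nat, forall N, (m <= N)%N -> forall p q : rat,
        normc (cpx (ratr p, ratr q)) < inner_radius r k ->
        m.+1%:R^-1 <= normc (powsum c (cpx (ratr p, ratr q)) N))).
Proof.
move=> r0; split=> [H k|H z zr].
  have bounded j : exists M : nat, forall n, normc (c n) * inner_radius r j ^+ n <= M%:R.
    have [j0 [_ jr]] := inner_radius_bounds r j r0.
    have [] := H (inner_radius r j)%:C%C; first by rewrite normc_real// ltW.
    move=> l [/tends_term_bounded[M HM] _]; exists M => n.
    by have := HM n; rewrite normc_real// ltW.
  split; first exact: bounded.
  have [M HM] := bounded k.+1.
  have [k0 [kk kr]] := inner_radius_bounds r k r0.
  (* The terms are bounded at the strictly larger radius of index [k.+1], as the tail estimate at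
     index [k] requires. *)
  have [] := disc_nonvanishing_uniform c _ _ _ kk HM.
    by move=> z zk; apply: H; exact: le_lt_trans kr.
  by move=> m Hm; exists m => N mN p q pq; apply: Hm => //; exact: ltW.
have [k zk] := lt_inner_radius _ _ r0 zr.
have [[M HM] [m Hm]] := H k.
have [l Hl] := bounded_tends _ _ _ _ zk HM.
exists l; split=> //; apply/eqP => l0.
have : m.+1%:R^-1 <= normc l.
  apply: (@tends_normc_ge _ _ _ _ _ m Hl) => N mN.
  by apply: powsum_ge_of_rat zk; exact: Hm.
rewrite l0 ComplexField.Normc.normc0 leNgt => /negP; apply.
by rewrite invr_gt0 ltr0n.
Qed.

End disc_nonvanishing.

(** * Measurability of the no-zero event *)

Section measurability.
Context {R : realType} {d : measure_display} {T : measurableType d}.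

Definition cmeas (g : T -> R[i]) : Prop :=
  measurable_fun setT (fun w => complex.Re (g w)) /\
  measurable_fun setT (fun w => complex.Im (g w)).

Lemma cmeasD g h : cmeas g -> cmeas h -> cmeas (fun w => g w + h w).
Proof.
move=> [g1 g2] [h1 h2]; split.
  rewrite (_ : (fun w => _) = (fun w => complex.Re (g w) + complex.Re (h w))); last first.
    by apply/funext => x; case: (g x) => ? ?; case: (h x).
  exact: measurable_funD.
rewrite (_ : (fun w => _) = (fun w => complex.Im (g w) + complex.Im (h w))); last first.
  by apply/funext => x; case: (g x) => ? ?; case: (h x).
exact: measurable_funD.
Qed.

Lemma cmeasMr g (z : R[i]) : cmeas g -> cmeas (fun w => g w * z).
Proof.
move=> [g1 g2]; case: z => a b; split.
  rewrite (_ : (fun w => _) = (fun w => complex.Re (g w) * a - complex.Im (g w) * b)); last first.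
    by apply/funext => x; case: (g x).
  by apply: measurable_funB; apply: measurable_funM.
rewrite (_ : (fun w => _) = (fun w => complex.Re (g w) * b + complex.Im (g w) * a)); last first.
  by apply/funext => x; case: (g x).
by apply: measurable_funD; apply: measurable_funM.
Qed.

Lemma measurable_normc g : cmeas g -> measurable_fun setT (fun w => normc (g w)).
Proof.
move=> [g1 g2].
rewrite (_ : (fun w => _) =
    Num.sqrt \o (fun w => complex.Re (g w) ^+ 2 + complex.Im (g w) ^+ 2)); last first.
  by apply/funext => x; rewrite normcE.
apply: measurableT_comp; first by apply: continuous_measurable_fun; exact: sqrt_continuous.
by apply: measurable_funD; apply: measurable_funX.
Qed.

Lemma measurable_le_cst (f : T -> R) (b : R) : measurable_fun setT f ->
  measurable [set w | f w <= b].
Proof.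
move=> mf; rewrite (_ : [set w | _] = f @^-1` `]-oo, b]%classic); last first.
  by apply/seteqP; split=> w /=; rewrite in_itv.
by rewrite -[X in measurable X]setTI; apply: mf => //; exact: measurable_itv.
Qed.

Lemma measurable_ge_cst (f : T -> R) (b : R) : measurable_fun setT f ->
  measurable [set w | b <= f w].
Proof.
move=> mf; rewrite (_ : [set w | _] = f @^-1` `[b, +oo[%classic); last first.
  by apply/seteqP; split=> w /=; rewrite in_itv /= andbT.
by rewrite -[X in measurable X]setTI; apply: mf => //; exact: measurable_itv.
Qed.

Lemma measurable_no_zero_event (X Y : nat -> T -> R) (a : nat -> R[i]) (r : R) :
  (forall n, measurable_fun setT (X n)) -> (forall n, measurable_fun setT (Y n)) ->
  0 < r -> measurable (no_zero_event X Y a r).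
Proof.
move=> mX mY r0.
pose c w n := xi X Y n w * a n.
have mc n : cmeas (c^~ n) by apply: cmeasMr; split; [exact: mX|exact: mY].
have mS z N : cmeas (fun w => powsum (c w) z N).
  elim: N => [|N IH].
    rewrite (_ : (fun _ => _) = (fun=> 0)); first by split; exact: measurable_cst.
    by apply/funext => w; rewrite /powsum big_ord0.
  rewrite (_ : (fun _ => _) = (fun w => powsum (c w) z N + c w N * z ^+ N)).
    by apply: cmeasD => //; apply: cmeasMr.
  by apply/funext => w; rewrite /powsum big_ord_recr.
pose rho k := inner_radius r k.
pose B k := \bigcup_M \bigcap_n [set w | normc (c w n) * rho k ^+ n <= M%:R].
(* Pairs of rationals are numbered through [unpickle]; a number that codes no pair imposes no
   condition. *)
pose V k i m N : set T := [set w | if unpickle i is Some (p, q) then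
  (normc (cpx (ratr p, ratr q) : R[i]) < rho k) ->
    m.+1%:R^-1 <= normc (powsum (c w) (cpx (ratr (p : rat), ratr (q : rat))) N) else True].
pose G k := \bigcup_m \bigcap_(N in [set N | (m <= N)%N]) \bigcap_i V k i m N.
have -> : no_zero_event X Y a r = \bigcap_k (B k `&` G k).
  apply/seteqP; split=> w.
  - move=> /(nonvanishing_countable (c w) _ r0) H k _; have [[M HM] [m Hm]] := H k.
    split; first by exists M => // n _; exact: HM.
    exists m => // N mN i _; rewrite /V /mkset; case: (unpickle i) => // -[p q].
    exact: (Hm N mN p q).
  - move=> H; apply/(nonvanishing_countable (c w) _ r0) => k.
    have [[M _ HM] [m _ Hm]] := H k I; split; first by exists M => n; exact: HM.
    exists m => N mN p q; have := Hm N mN (pickle (p, q)) I.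
    by rewrite /V /mkset pickleK; exact.
apply: bigcapT_measurable => k; apply: measurableI.
  apply: bigcup_measurable => M _; apply: bigcapT_measurable => n.
  apply: measurable_le_cst; apply: measurable_funM => //; exact: measurable_normc.
apply: bigcup_measurable => m _; apply: bigcap_measurableType => N _.
apply: bigcapT_measurable => i; rewrite /V; case: (unpickle i) => [[p q]|]; last exact: measurableT.
have [h|h] := pselect (normc (cpx (ratr p, ratr q) : R[i]) < rho k); last first.
  by rewrite (_ : [set w | _] = setT)//; apply/seteqP; split => // w _ /h.
rewrite (_ : [set w | _] = [set w | m.+1%:R^-1 <= normc (powsum (c w) (cpx (ratr p, ratr q)) N)]).
  by apply: measurable_ge_cst; exact: measurable_normc.
by apply/seteqP; split => w; rewrite /mkset => // H; apply: H.
Qed.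

End measurability.

(** * The counting function and the exceptional set *)

Section counting.
Context {R : realType}.
Variable a : nat -> R[i].

Definition aterm (r : R) (n : nat) : R := normc (a n) * r ^+ n.

Lemma term_ge0 r n : 0 <= r -> 0 <= aterm r n.
Proof. by move=> r0; rewrite mulr_ge0 ?normc_ge0 ?exprn_ge0. Qed.

Lemma le_term r s n : 0 <= r -> r <= s -> aterm r n <= aterm s n.
Proof.
by move=> r0 rs; rewrite ler_wpM2l ?normc_ge0// lerXn2r ?nnegrE// (le_trans r0).
Qed.

(** A nonnegative sequence with upper limit 0 tends to 0, so eventually the [n]-th root of [|a_n|]
    is below [1 / r]. *)
Lemma term_eventually_le1 :
  limn_esup (fun n : nat => (normc (a n) `^ (n%:R^-1))%:E) = 0%E ->
  forall r, 0 < r -> exists M, forall n, (M <= n)%N -> aterm r n <= 1.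
Proof.
move=> Hl r r0.
have : (fun n : nat => (normc (a n) `^ (n%:R^-1))%:E) @ \oo --> 0%:E.
  apply: limn_esup_le_cvg; first by rewrite Hl.
  by move=> n; rewrite lee_fin powR_ge0.
move=> /fine_cvgP[_ /cvgrPdist_lt /(_ r^-1)]; rewrite invr_gt0 => /(_ r0) [M _ HM].
(* The successor excludes [n = 0], where [n%:R^-1] is the default value 0 and no root is taken. *)
exists M.+1 => n Mn; have := HM n (ltnW Mn).
rewrite /= sub0r normrN ger0_norm ?powR_ge0// => h.
have n0 : (0 < n)%N by apply: leq_trans Mn.
have aE : normc (a n) = (normc (a n) `^ n%:R^-1) ^+ n.
  by rewrite -powR_mulrn ?powR_ge0// -powRrM mulVf ?powRr1 ?normc_ge0// pnatr_eq0 -lt0n.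
rewrite /aterm aE -exprMn exprn_ile1//; first by rewrite mulr_ge0 ?powR_ge0// ltW.
by rewrite -ler_pdivlMr// div1r ltW.
Qed.

Hypothesis small : forall r, 0 < r -> exists M, forall n, (M <= n)%N -> aterm r n <= 1.
Hypothesis nonzero : forall m : nat, exists2 n : nat, (m <= n)%N & a n != 0.

Definition partial_count r M : nat := \sum_(n < M) (1 < aterm r n)%R.

(** The value at which the partial counts stabilise; [countP] shows that it exists for [0 < r]. *)
Definition ncount r : nat :=
  get [set N | exists M0, forall M, (M0 <= M)%N -> partial_count r M = N].

Lemma leq_partial_count r : {homo partial_count r : m n / (m <= n)%N}.
Proof.
apply: homo_leq => // [x y z|n]; first exact: leq_trans.
by rewrite /partial_count big_ord_recr leq_addr.
Qed.

Lemma countP r : 0 < r ->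
  exists M0, forall M, (M0 <= M)%N -> partial_count r M = ncount r.
Proof.
move=> r0; rewrite /ncount.
apply: (@getPex _ [set N | exists M0, forall M, (M0 <= M)%N -> partial_count r M = N]).
have [M0 HM] := small _ r0; exists (partial_count r M0), M0 => M.
elim: M => [|M IH]; first by rewrite leqn0 => /eqP->.
rewrite leq_eqVlt => /predU1P[<-//|]; rewrite ltnS => MM.
by rewrite /partial_count big_ord_recr /= -/(partial_count r M) IH// ltNge HM //= addn0.
Qed.

Lemma partial_count_le r M : 0 < r -> (partial_count r M <= ncount r)%N.
Proof.
move=> /countP[M0 H]; rewrite -(H _ (leq_maxr M M0)).
exact/leq_partial_count/leq_maxl.
Qed.

Lemma leq_count r s : 0 < r -> r <= s -> (ncount r <= ncount s)%N.
Proof.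
move=> r0 rs; have [M1 H1] := countP _ r0.
rewrite -(H1 _ (leqnn _)); apply: leq_trans (partial_count_le _ M1 (lt_le_trans r0 rs)).
apply: leq_sum => n _; have [h|//] := boolP (1 < aterm r n).
by rewrite (lt_le_trans h)// le_term// ltW.
Qed.

(** Each induction step adds a nonzero coefficient of index [n] beyond the range already counted.
    Since [n >= 1] and [r >= 1], the condition [r > 1 / |a_n|] forces [|a_n| r^n > 1]. *)
Lemma count_unbounded k : exists r0, 1 <= r0 /\ forall r, r0 <= r -> (k <= ncount r)%N.
Proof.
suff [M [r0 [r1 H]]] : exists M r0, 1 <= r0 /\ forall r, r0 <= r -> (k <= partial_count r M)%N.
  exists r0; split => // r rr; apply: leq_trans (H r rr) (partial_count_le _ _ _); lra.
elim: k => [|k [M [r0 [r1 H]]]]; first by exists 0%N, 1; split.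
have [n Mn an0] := nonzero M.+1.
have an := normc_gt0 _ an0.
exists n.+1, (r0 + (normc (a n))^-1); have ia : 0 < (normc (a n))^-1 by rewrite invr_gt0.
split=> [|r rr]; first lra.
rewrite /partial_count big_ord_recr /= -/(partial_count r n).
suff -> : 1 < aterm r n.
  rewrite addn1 ltnS; apply: leq_trans (H r _) (leq_partial_count _ _ _ _); first lra.
  exact: leq_trans Mn.
have rx : (normc (a n))^-1 < r by lra.
have h1 : 1 < normc (a n) * r by rewrite mulrC -ltr_pdivrMr// div1r.
apply: (lt_le_trans h1); rewrite /aterm ler_wpM2l ?normc_ge0//.
by rewrite -[leLHS]expr1 ler_weXn2l//; [lra|exact: leq_trans Mn].
Qed.

Lemma eseries_finite (u : nat -> R) (M0 : nat) :
  (forall n, (M0 <= n)%N -> u n = 0) ->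
  (\sum_(0 <= n <oo) (u n)%:E)%E = (\sum_(n < M0) u n)%:E.
Proof.
move=> u0; apply: cvg_lim => //; apply: cvg_near_cst; exists M0 => // M /= MM.
rewrite sumEFin (big_cat_nat (leq0n _) MM)/= big_mkord.
rewrite [X in _ + X](_ : _ = 0) ?addr0//.
by rewrite big_nat_cond big1// => i /andP[/andP[/u0]].
Qed.

(** The conditions [0 < ln b] and [1 < b] agree for [b >= 0], including [b = 0], where [ln] has the
    default value 0. *)
Lemma NcountE r : 0 < r -> Ncount a r = (ncount r)%:R%:E.
Proof.
move=> r0; have [M1 H1] := countP _ r0; have [M2 H2] := small _ r0.
rewrite /Ncount (eseries_finite _ (maxn M1 M2)).
  rewrite -(H1 _ (leq_maxl M1 M2)) /partial_count natr_sum; congr EFin.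
  apply: eq_bigr => n _; rewrite -/(aterm r n).
  have [h|h] := ltP 1 (aterm r n); first by rewrite ln_gt0.
  by rewrite ltNge ln_le0.
by move=> n; rewrite geq_max => /andP[_ /H2 h]; rewrite ltNge ln_le0.
Qed.

Definition log_term r n : R := if 1 < aterm r n then ln (aterm r n) else 0.

Lemma s_rE r : 0 < r -> exists S : R, s_r a r = (2 * S)%:E /\
  forall M, \sum_(n < M) log_term r n <= S.
Proof.
move=> r0; have [M0 H] := small _ r0.
have pos n : 0 <= log_term r n.
  by rewrite /log_term; case: ifPn => // h; rewrite ln_ge0// ltW.
have zero n : (M0 <= n)%N -> log_term r n = 0.
  by move=> /H h; rewrite /log_term ltNge h.
exists (\sum_(n < M0) log_term r n); split.
  rewrite /s_r EFinM; congr (_ * _)%E; rewrite -(eseries_finite _ _ zero).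
  apply: eq_eseriesr => n _; rewrite -/(aterm r n) /log_term.
  have [h|h] := ltP 1 (aterm r n); first by rewrite ln_gt0.
  by rewrite ltNge ln_le0.
move=> M; rewrite -!(big_mkord xpredT (log_term r)).
have [MM|/ltnW MM] := leqP M M0.
  by rewrite (big_cat_nat (leq0n _) MM)/= lerDl sumr_ge0.
rewrite (big_cat_nat (leq0n _) MM)/= [X in _ + X](_ : _ = 0) ?addr0//.
by rewrite big_nat_cond big1// => i /andP[/andP[/zero]].
Qed.

Definition late_entry r s n : bool := ~~ (1 < aterm r n) && (1 < aterm s n).

Lemma sum_late_entry_le r s M : 0 < r -> r <= s ->
  (\sum_(n < M) late_entry r s n <= ncount s - ncount r)%N.
Proof.
move=> r0 rs; have s0 := lt_le_trans r0 rs.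
have [M1 H1] := countP _ r0; have [M2 H2] := countP _ s0.
pose M' := maxn M (maxn M1 M2).
have MM : (M <= M')%N by rewrite leq_maxl.
apply: (@leq_trans (\sum_(n < M') late_entry r s n)).
  rewrite -!(big_mkord xpredT (fun n => late_entry r s n : nat)).
  by rewrite (big_cat_nat (leq0n _) MM)/= leq_addr.
rewrite -(H1 M') ?leq_max ?leqnn ?orbT// -(H2 M') ?leq_max ?leqnn ?orbT//.
rewrite leq_subRL; last first.
  apply: leq_sum => n _; have [h|//] := boolP (1 < aterm r n).
  by rewrite (lt_le_trans h)// le_term// ltW.
rewrite /partial_count -big_split /=; apply: leq_sum => n _.
rewrite /late_entry; have [h|//] := boolP (1 < aterm r n).
by rewrite (lt_le_trans h)// le_term// ltW.
Qed.

(** If [r] lies below [sup (S j) / q^2], some element of [S j] exceeds [r q^2], and monotonicity of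
    the count gives the claim. The removed intervals leave no other position for [r]; one more
    interval removes the radii up to [r0]. *)
Lemma exceptional_set (r0 : R) : 1 <= r0 ->
  exists E : set R, [/\ E `<=` `]1, +oo[%classic, finite_log_measure E &
    forall r, 1 < r -> ~ E r -> r0 < r /\
      forall j, (ncount r < j.+1 ^ 2)%N ->
        (ncount (r * (1 + gap j) ^+ 2) < j.+1 ^ 2)%N].
Proof.
move=> r01.
(* The point 1 is put in by hand, so that [S j] is nonempty and its supremum at least 1 even when
   the count at 1 is already too large. *)
pose S j := [set r : R | r = 1 \/ (1 <= r /\ (ncount r < j.+1 ^ 2)%N)].
have S1 j : S j 1 by left.
have Ss j : has_sup (S j).
  split; first by exists 1.
  have [s [s1 Hs]] := count_unbounded (j.+1 ^ 2); exists s => r [->//|[r1 Hr]].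
  by rewrite leNgt; apply/negP => /ltW /Hs; rewrite leqNgt Hr.
have sup1 j : 1 <= sup (S j) by apply: ub_le_sup => //; exact: (Ss j).2.
pose q j : R := 1 + gap j.
have q1 j : 1 < q j by rewrite /q ltrDl gap_gt0.
have qq j : 1 < q j ^+ 2 by rewrite exprn_egt1.
have qq0 j : 0 < q j ^+ 2 by apply: lt_trans (qq j).
(* Index 0 is the initial segment [[1, r0]]; index [j.+1] is the interval ending at [sup (S j)]. *)
pose l i := if i is j.+1 then sup (S j) / q j ^+ 2 else 1.
pose u i := if i is j.+1 then sup (S j) else r0.
exists (`]1, +oo[%classic `&` \bigcup_i `[l i, u i]%classic); split.
- exact: subIsetl.
(* The initial segment contributes [r0 - 1]. The others contribute [q^2 - 1 = 2 g + g^2 <= 3 g]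
   each, and the gaps sum to at most 1. *)
- apply: (@finite_log_measure_bigcup _ _ _ (r0 - 1 + 3)).
    case=> [|j] /=; first by rewrite ltr01.
    have sp : 0 < sup (S j) by exact: lt_le_trans ltr01 (sup1 j).
    apply/andP; split; first exact: divr_gt0.
    by rewrite ler_pdivrMr// ler_peMr// ltW.
  case=> [|M]; first by rewrite big_ord0; lra.
  rewrite big_ord_recl /= divr1 lerD2l.
  apply: (@le_trans _ _ (\sum_(j < M) 3 * gap j)); last first.
    by rewrite -mulr_sumr; have := @sum_gap_le1 R M; lra.
  apply: ler_sum => j _ /=; rewrite add0n.
  have sp : sup (S j) != 0 by rewrite gt_eqF// (lt_le_trans ltr01).
  rewrite invfM invrK mulrA divff// mul1r /q.
  have := @gap_le1 R j; have := @gap_gt0 R j; nra.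
- move=> r r1 Er.
  have {}Er i : l i <= r <= u i -> False.
    move=> h; apply: Er; split; first by rewrite /= in_itv /= r1.
    by exists i => //; rewrite /= in_itv.
  split=> [|j Hj].
    by rewrite ltNge; apply/negP => h; apply: (Er 0%N); rewrite /= h ltW.
  have rS : r <= sup (S j).
    by apply: ub_le_sup; [exact: (Ss j).2|right; split=> //; exact: ltW].
  have : r < sup (S j) / q j ^+ 2.
    by rewrite ltNge; apply/negP => h; apply: (Er j.+1); rewrite /= h rS.
  rewrite ltr_pdivlMr// => h.
  have [s Ss' hs] := sup_gt (Ss j).1 h.
  have r2 : 1 < r * q j ^+ 2 by rewrite mulr_egt1.
  case: Ss' => [s1|[_ Hs]]; first by have := lt_trans r2 hs; rewrite s1 ltxx.
  by apply: leq_ltn_trans Hs; apply: leq_count; [exact: lt_trans r2|exact: ltW].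
Qed.

End counting.

(** * The lower bound for the probability *)

Lemma sum_geometric_le {R : realType} (g : R) M : 0 < g ->
  \sum_(1 <= n < M) (1 + g)^-1 ^+ n <= g^-1.
Proof.
move=> g0; pose x := (1 + g)^-1; have x0 : 0 < x by rewrite invr_gt0; lra.
case: M => [|M]; first by rewrite big_geq// invr_ge0 ltW.
suff -> : \sum_(1 <= n < M.+1) x ^+ n = (1 - x ^+ M) / g.
  by rewrite ler_pdivrMr// mulVf ?gt_eqF// gerBl exprn_ge0// ltW.
elim: M => [|M IH]; first by rewrite big_geq// expr0 subrr mul0r.
rewrite big_nat_recr//= IH exprS.
have xg : x * g = 1 - x by rewrite /x; field; lra.
apply: (mulIf (lt0r_neq0 g0)); rewrite mulrDl !divfK ?gt_eqF//.
by rewrite mulrAC xg; ring.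
Qed.

Lemma floor_sqrt (N : nat) : exists j, (j ^ 2 <= N < j.+1 ^ 2)%N.
Proof.
elim: N => [|N [j /andP[h1 h2]]]; first by exists 0%N.
have [h|h] := ltnP N.+1 (j.+1 ^ 2); first by exists j; rewrite h leqW.
exists j.+1; rewrite h /=; apply: leq_ltn_trans h2 _; rewrite ltn_exp2r//.
Qed.

Lemma leq_sub_sqr (j m n : nat) :
  (j ^ 2 <= m)%N -> (n < j.+1 ^ 2)%N -> (n - m <= j.*2.+1)%N.
Proof. by rewrite -!mulnn => h1 h2; nia. Qed.

Section lower_bound.
Context {R : realType} {d : measure_display} {T : measurableType d}.
Variables (P : probability T R) (X Y : nat -> T -> R) (a : nat -> R[i]).
Hypothesis gauss : forall n, std_complex_gaussian P (X n) (Y n).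
Hypothesis indep : mutually_independent P X Y.
Hypothesis small : forall r, 0 < r -> exists M, forall n, (M <= n)%N -> aterm a r n <= 1.
Hypothesis a0_neq0 : a 0%N != 0.

(** [D] bounds the number of late entries, the indices with [b_n <= 1 < b_n q^(2n)]. Everything is
    explicit in [g], [D] and [N], so that [j] can be chosen afterwards as a function of [r]. *)
Lemma no_zero_prob_ge : exists C : R, 0 <= C /\ forall (r g S : R) (D : nat),
  0 < r -> 0 < g -> (0 < ncount a r)%N ->
  (ncount a (r * (1 + g) ^+ 2) - ncount a r <= D)%N ->
  (forall M, \sum_(n < M) log_term a r n <= S) ->
  let K := 1 + D%:R + g^-1 in let N : R := (ncount a r)%:R in
  (p0 P X Y a r <=
     (C * (K * (normc (a 0%N))^-1 + 1) ^+ 2 + N * (C + 2 * ln N) + C * D%:R + C / g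
      + 2 * S)%:E)%E.
Proof.
have [C [C0 bounds]] := gauss_prob_bounds P.
exists C; split => // r g S D r0 g0 N0 HD HS; cbv zeta.
set K := 1 + D%:R + g^-1; set N : R := (ncount a r)%:R.
set W := (X in (_ <= X%:E)%E).
have N1 : 1 <= N by rewrite /N ler1n.
have Npos : 0 < N by rewrite ltr0n.
have an0 : 0 < normc (a 0%N) by exact: normc_gt0.
have gi : 0 < g^-1 by rewrite invr_gt0.
have K0 : 0 < K by rewrite /K addr_gt0// ltr_pwDl.
pose q := 1 + g; have q1 : 1 <= q by rewrite lerDl ltW.
have q0 : 0 < q by rewrite (lt_le_trans ltr01).
pose s := r * q ^+ 2.
have rs : r <= s by rewrite ler_peMr ?exprn_ege1// ltW.
have b0 n : 0 <= aterm a r n by rewrite term_ge0// ltW.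
pose rho n := if 1 < aterm a r n then (N * aterm a r n)^-1
  else if 1 < aterm a s n then 1 else q ^+ n.
(* These bound minus the logarithm of the probability of [disc (rho n)]. In the first case
   [- 2 ln (rho n)] splits into [2 ln N] and twice the log term; in the last, [C / q^(2n)] is
   weakened to [C / q^n], with sum at most [C / g]. *)
pose w n := if 1 < aterm a r n then C + 2 * ln N + 2 * log_term a r n
  else if 1 < aterm a s n then C else C * q^-1 ^+ n.
have rho0 n : 0 < rho n.
  rewrite /rho; case: ifPn => [h|_]; last by case: ifP => // _; rewrite exprn_gt0.
  by rewrite invr_gt0 mulr_gt0// (lt_trans ltr01).
have sE n : aterm a s n = aterm a r n * (q ^+ n) ^+ 2.
  by rewrite /aterm /s exprMn mulrA -!exprM mulnC.
have xi0 n : 0 <= q^-1 ^+ n by rewrite exprn_ge0// invr_ge0 ltW.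
have sum_late M : \sum_(1 <= n < M) (late_entry a r s n)%:R <= D%:R :> R.
  rewrite -natr_sum ler_nat; apply: leq_trans HD.
  apply: leq_trans (sum_late_entry_le a small r s M r0 rs).
  rewrite -(big_mkord xpredT (fun n => late_entry a r s n : nat)).
  by case: M => [|M]; [rewrite big_geq|rewrite [leqRHS]big_ltn// leq_addl].
have sum_count M : \sum_(1 <= n < M) (1 < aterm a r n)%R%:R <= N :> R.
  rewrite -natr_sum ler_nat; apply: leq_trans (partial_count_le a small r M r0).
  rewrite /partial_count -(big_mkord xpredT (fun n => (1 < aterm a r n)%R : nat)).
  by case: M => [|M]; [rewrite big_geq|rewrite [leqRHS]big_ltn// leq_addl].
have sum_log M : \sum_(1 <= n < M) log_term a r n <= S.
  apply: le_trans (HS M); rewrite -(big_mkord xpredT (log_term a r)).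
  case: M => [|M]; [by rewrite !big_geq|rewrite [leRHS]big_ltn// lerDr].
  by rewrite /log_term; case: ifPn => // h; rewrite ln_ge0// ltW.
(* The three cases contribute at most [N * (1 / N)], [D] and [1 / g]. In the last one
   [b_n q^(2n) <= 1] turns [q^n b_n] into at most [q^(- n)]. *)
have sum_rho M : \sum_(1 <= n < M) rho n * aterm a r n <= K.
  apply: (@le_trans _ _ (\sum_(1 <= n < M) (N^-1 * (1 < aterm a r n)%R%:R
      + (late_entry a r s n)%:R + q^-1 ^+ n))).
    apply: ler_sum => n _; rewrite /rho /late_entry.
    case: ifPn => [h|h] /=.
      have t0 : aterm a r n != 0 by rewrite gt_eqF// (lt_trans ltr01).
      by rewrite invfM mulfVK//= mulr1 addr0 lerDl.
    rewrite -leNgt in h; case: ifPn => [_|h']; first by rewrite mulr0 add0r mul1r; have := xi0 n; rewrite /=; lra.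
    rewrite mulr0 !add0r exprVn -[leRHS]mul1r ler_pdivlMr ?exprn_gt0//.
    by rewrite mulrAC mulrC -expr2 -sE leNgt.
  rewrite !big_split /= -mulr_sumr /K; apply: lerD; last exact: sum_geometric_le.
  by apply: lerD => //; rewrite ler_pdivrMl// mulr1.
have sum_w M : \sum_(1 <= n < M) w n <= N * (C + 2 * ln N) + C * D%:R + C / g + 2 * S.
  apply: (@le_trans _ _ (\sum_(1 <= n < M) ((C + 2 * ln N) * (1 < aterm a r n)%R%:R
      + C * (late_entry a r s n)%:R + C * q^-1 ^+ n + 2 * log_term a r n))).
    apply: ler_sum => n _; rewrite /w /late_entry.
    have Cx : 0 <= C * q^-1 ^+ n by rewrite mulr_ge0.
    case: ifPn => [h|h] /=; first by rewrite mulr1 mulr0; lra.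
    by rewrite {1}/log_term (negbTE h); case: ifP => _ /=; rewrite ?mulr1 ?mulr0; lra.
  rewrite !big_split /= -!mulr_sumr.
  have lN : 0 <= ln N by rewrite ln_ge0.
  apply: lerD; last by rewrite ler_wpM2l.
  apply: lerD; last by rewrite ler_wpM2l// sum_geometric_le.
  apply: lerD; last by rewrite ler_wpM2l.
  by rewrite mulrC ler_wpM2r//; lra.
(* Index 0 is the only one where the coefficient must be large: there [|xi_0 a_0| > K]. *)
pose A n := if n is 0%N then outside (K / normc (a 0%N)) else disc (rho n).
pose w' n := if n is 0%N then C * (K / normc (a 0%N) + 1) ^+ 2 else w n.
have mA n : measurable (A n).
  by case: n => [|n]; [exact: measurable_outside|exact: measurable_disc].
have mX n : measurable_fun setT (X n) by case: (gauss n).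
have mY n : measurable_fun setT (Y n) by case: (gauss n) => _ [].
have probA n : ((expR (- w' n))%:E <= P [set v | A n (X n v, Y n v)])%E.
  have [out le1 ge1] := bounds _ _ (gauss n).
  case: n out le1 ge1 => [|n] out le1 ge1; first by apply: out; rewrite divr_ge0// ltW.
  rewrite /w' /A /w /rho; case: ifPn => [h|h].
    have t0 : 0 < aterm a r n.+1 by rewrite (lt_trans ltr01).
    have Nt0 : 0 < N * aterm a r n.+1 by exact: mulr_gt0.
    apply: le_trans (le1 _ _).
      rewrite lee_fin ler_expR lnV ?posrE// lnM ?posrE// /log_term h; lra.
    rewrite invr_gt0 Nt0 /= invf_le1//.
    by rewrite -[leLHS]mulr1 ler_pM// ltW.
  case: ifPn => [_|_].
    by apply: le_trans (le1 _ _); rewrite ?ln1 ?mulr0 ?sub0r// ltr01 lexx.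
  apply: le_trans (ge1 _ _); last by rewrite exprn_ege1.
  rewrite lee_fin ler_expR lerN2 ler_wpM2l// exprVn lef_pV2 ?posrE ?exprn_gt0//.
  by rewrite expr2 ler_peMr ?exprn_ege1// exprn_ge0// ltW.
have sum_w' M : \sum_(n < M) w' n <= W.
  rewrite -(big_mkord xpredT w'); case: M => [|M].
    rewrite big_geq// /W; have lN : 0 <= ln N by rewrite ln_ge0.
    have := sum_w 0%N; rewrite big_geq//.
    have : 0 <= C * (K / normc (a 0%N) + 1) ^+ 2 by rewrite mulr_ge0// sqr_ge0.
    lra.
  rewrite big_ltn//= (eq_big_nat _ _ (F2 := w)); last by case.
  by have := sum_w M.+1; rewrite /W; lra.
have PW := prob_bigcap_ge P X Y A w' W mX mY indep mA probA sum_w'.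
have {}PW : ((expR (- W))%:E <= P (no_zero_event X Y a r))%E.
  apply: le_trans PW _; apply: le_measure; rewrite ?inE.
  - apply: bigcapT_measurable => n; rewrite -[X in measurable X]setTI.
    by apply: measurable_fun_pair => //.
  - exact: measurable_no_zero_event.
  move=> v Hv; rewrite /no_zero_event /=.
  apply: (@dominated_nonvanishing _ (fun n => xi X Y n v * a n) r K).
    move=> M; apply: le_trans (sum_rho M).
    rewrite !big_nat; apply: ler_sum => -[//|n] _.
    rewrite ComplexField.Normc.normcM -mulrA; apply: ler_wpM2r; first exact: (b0 n.+1).
    have := Hv n.+1 I; rewrite /A /disc /= => h.
    by rewrite -(ger0_norm (ltW (rho0 n.+1))) -sqrtr_sqr; exact: ler_wsqrtr.
  rewrite ComplexField.Normc.normcM -ltr_pdivrMr//.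
  have := Hv 0%N I; rewrite /A /outside /= => h.
  have Ka0 : 0 <= K / normc (a 0%N) by rewrite divr_ge0// ltW.
  rewrite -(ger0_norm Ka0) -sqrtr_sqr ltr_sqrt//.
  by apply: le_lt_trans h; rewrite sqr_ge0.
rewrite /p0 leeNl -EFinN.
rewrite -[(- W)%R](expRK) -lne_EFin ?expR_gt0//.
rewrite lee_lne// in_itv /= leey andbT.
  by rewrite lee_fin expR_ge0.
exact: measure_ge0.
Qed.

End lower_bound.

(** * Combination of the exceptional set, the probability bound and the cost estimate *)

Theorem theorem4p1 (R : realType) (d : measure_display) (T : measurableType d)
  (P : probability T R) (X Y : nat -> T -> R) (a : nat -> R[i]) (eps : R) :
  0 < eps ->
  (forall n, std_complex_gaussian P (X n) (Y n)) ->
  mutually_independent P X Y ->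
  (forall m : nat, exists2 n : nat, (m <= n)%N & a n != 0) ->
  limn_esup (fun n : nat => (normc (a n) `^ (n%:R^-1))%:E) = 0%E ->
  a 0%N != 0 ->
  exists E : set R,
    E `<=` `]1, +oo[%classic /\ finite_log_measure E /\
    forall r : R, 1 < r -> ~ E r ->
      (p0 P X Y a r <=
         s_r a r + Ncount a r *
           (expR ((2 + eps) * Num.sqrt (ln (fine (Ncount a r)))))%:E)%E.
Proof.
move=> eps0 gauss indep nonzero limsup0 a0.
have small := term_eventually_le1 a limsup0.
have [C [C0 prob_ge]] := no_zero_prob_ge P X Y a gauss indep small a0.
have ia : 0 <= (normc (a 0%N))^-1 by rewrite invr_ge0 normc_ge0.
have [N0 cost] := cost_le C _ eps C0 ia eps0.
(* The maximum makes the count both large enough for [cost] and positive, as [prob_ge] asks. *)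
have [r0 [r01 Hr0]] := count_unbounded a small nonzero (maxn N0 1).
have [E [E1 Elog HE]] := exceptional_set a small nonzero r0 r01.
exists E; split => //; split => // r r1 Er.
have [r0r Hq] := HE r r1 Er.
have rpos : 0 < r by exact: lt_trans r1.
have := Hr0 r (ltW r0r); rewrite geq_max => /andP[hN0 hN1].
have [j /andP[hj hj']] := floor_sqrt (ncount a r).
have [S [sE HS]] := s_rE a small r rpos.
rewrite sE (NcountE a small r rpos) /= -EFinM -EFinD.
(* Outside [E] the counts at [r] and at [r (1 + gap j)^2] both lie in [[j^2, (j + 1)^2)], hence the
   value [2 j + 1] for [D]. *)
apply: le_trans (prob_ge r (gap j) S j.*2.+1 rpos (gap_gt0 j) hN1 _ HS) _.
  exact: leq_sub_sqr hj (Hq j hj').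
by rewrite lee_fin [leRHS]addrC lerD2r; exact: cost hN0 hj.
Qed.
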